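(* Let $R$ and $S$ be associative rings and let ${}_SC_R$ be a semidualizing $(S,R)$-bimodule. Write $\mathcal{P}(R)$ and $\mathcal{F}(R)$ for the full subcategories of projective and of flat $R$-modules, and $\mathcal{I}(S)$ for the full subcategory of injective $S$-modules. Then there are inclusions $$\mathcal{P}(R)\subseteq\mathcal{F}(R)\subseteq\mathcal{A}_C(R)\supseteq\mathcal{I}_C(R),\qquad \mathcal{P}_C(S)\subseteq\mathcal{F}_C(S)\subseteq\mathcal{B}_C(S)\supseteq\mathcal{I}(S),$$ and the functors $C\otimes_R-$ (from left to right) and $\operatorname{Hom}_S(C,-)$ (from right to left) restrict to mutually quasi-inverse equivalences of categories $$\mathcal{P}(R)\simeq\mathcal{P}_C(S),\qquad \mathcal{F}(R)\simeq\mathcal{F}_C(S),\qquad \mathcal{A}_C(R)\simeq\mathcal{B}_C(S),\qquad \mathcal{I}_C(R)\simeq\mathcal{I}(S).$$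
   Context: Rings are associative with unity (not necessarily commutative or noetherian). Modules are unital left modules; right $R$-modules are identified with left $R^{\mathrm{op}}$-modules. An $(S,R)$-bimodule $C={}_SC_R$ is semidualizing if: (a1) ${}_SC$ admits a degreewise finite $S$-projective resolution (a projective resolution by finitely generated projectives); (a2) $C_R$ admits a degreewise finite $R^{\mathrm{op}}$-projective resolution; (b1) the homothety map $S\to\operatorname{Hom}_{R^{\mathrm{op}}}(C,C)$, $s\mapsto(x\mapsto sx)$, is an isomorphism; (b2) the homothety map $R\to\operatorname{Hom}_S(C,C)$, $r\mapsto(x\mapsto xr)$, is an isomorphism; (c1) $\operatorname{Ext}_S^{i}(C,C)=0$ for all $i\geq1$; (c2) $\operatorname{Ext}_{R^{\mathrm{op}}}^{i}(C,C)=0$ for all $i\geq 1$. The Auslander class $\mathcal{A}_C(R)$ consists of all $R$-modules $M$ with (A1) $\operatorname{Tor}^R_i(C,M)=0$ for all $i\ge1$; (A2) $\operatorname{Ext}_S^i(C,C\otimes_RM)=0$ for all $i\ge1$; (A3) the natural map $\mu_M\colon M\to\operatorname{Hom}_S(C,C\otimes_RM)$, $m\mapsto(c\mapsto c\otimes m)$, is an isomorphism. The Bass class $\mathcal{B}_C(S)$ consists of all $S$-modules $N$ with (B1) $\operatorname{Ext}_S^i(C,N)=0$ for all $i\ge1$; (B2) $\operatorname{Tor}_i^R(C,\operatorname{Hom}_S(C,N))=0$ for all $i\ge1$; (B3) the natural evaluation map $\nu_N\colon C\otimes_R\operatorname{Hom}_S(C,N)\to N$, $c\otimes f\mapsto f(c)$,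 is an isomorphism. Both are regarded as full subcategories of the module categories. The $C$-flat, $C$-projective and $C$-injective modules are (as full subcategories, closed under isomorphism) $\mathcal{F}_C(S)=\{C\otimes_RF\mid {}_RF\text{ flat}\}$, $\mathcal{P}_C(S)=\{C\otimes_RP\mid {}_RP\text{ projective}\}$, $\mathcal{I}_C(R)=\{\operatorname{Hom}_S(C,I)\mid {}_SI\text{ injective}\}$. *)

(* Defs.v *)
From HB Require Import structures.
From mathcomp Require Import all_boot all_algebra generic_quotient ring_quotient.
From mathcomp Require Import boolp classical_sets functions fsbigop.

Set Implicit Arguments.
Unset Strict Implicit.
Unset Printing Implicit Defensive.

Import GRing.Theory.
Local Open Scope ring_scope.
Local Open Scope quotient_scope.

(* Rings are [pzRingType]s: associative, with unit, the zero ring included. *)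

Lemma linear_ext (R : pzRingType) (U V : lmodType R) (f g : {linear U -> V}) :
  f =1 g -> f = g.
Proof.
move=> /funext; case: f => f [[fs] [fz]]; case: g => g [[gs] [gz]] /= fg.
move: fs fz gs gz; rewrite fg => *; congr GRing.Linear.Pack.
congr GRing.Linear.Class; f_equal; exact: Prop_irrelevance.
Qed.

Section KernelHomology.
Variables U V : zmodType.
Implicit Type f : {additive U -> V}.

Definition ker_pred f : {pred U} := fun x => f x == 0.

Lemma ker_pred_closed f : zmod_closed (ker_pred f).
Proof.
split=> [|x y]; rewrite !unfold_in; first by rewrite raddf0.
by move=> /eqP fx /eqP fy; rewrite raddfB fx fy subr0.
Qed.

HB.instance Definition _ f :=
  GRing.isZmodClosed.Build U (ker_pred f) (ker_pred_closed f).

Record kernel f := Kernel { kernel_val :> U; _ : kernel_val \in ker_pred f }.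

HB.instance Definition _ f := [isSub for @kernel_val f].
HB.instance Definition _ f := [Choice of kernel f by <:].
HB.instance Definition _ f := [SubChoice_isSubZmodule of kernel f by <:].

End KernelHomology.

Section Homology.
Variables (A B D : zmodType) (f : {additive A -> B}) (g : {additive B -> D}).

Definition boundary : {pred kernel g} :=
  fun z => `[< exists a, f a = kernel_val z >].

Lemma boundary_closed : zmod_closed boundary.
Proof.
split=> [|x y]; rewrite !unfold_in; first by apply/asboolP; exists 0; rewrite raddf0.
move=> /asboolP[a fa] /asboolP[b fb]; apply/asboolP; exists (a - b).
by rewrite raddfB fa fb.
Qed.

HB.instance Definition _ :=
  GRing.isZmodClosed.Build (kernel g) boundary boundary_closed.

(* [ker g / im f], meant for [g \o f = 0]. *)
Definition homology : zmodType := Quotient.quot boundary.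

End Homology.

Section FreeModule.
Variables (R : pzRingType) (X : choiceType).

Definition finsupp : {pred X -> R^o} :=
  fun phi => `[< exists s : seq X, forall x, phi x != 0 -> x \in s >].

Lemma finsupp_closed : submod_closed finsupp.
Proof.
split=> [|a phi psi]; rewrite !unfold_in.
  by apply/asboolP; exists [::] => x; rewrite eqxx.
move=> /asboolP[s Hs] /asboolP[t Ht]; apply/asboolP; exists (s ++ t) => x.
rewrite mem_cat; case: (eqVneq (phi x) 0) => [p0|/Hs -> //].
case: (eqVneq (psi x) 0) => [q0|/Ht ->]; last by rewrite orbT.
move=> /negP[]; apply/eqP.
by rewrite -[LHS]/(a * phi x + psi x) p0 q0 mulr0 addr0.
Qed.

HB.instance Definition _ :=
  GRing.isSubmodClosed.Build R (X -> R^o) finsupp finsupp_closed.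

(* The free left [R]-module on the set [X]. *)
Record freemod := Freemod { freemod_val :> X -> R^o; _ : freemod_val \in finsupp }.

HB.instance Definition _ := [isSub for freemod_val].
HB.instance Definition _ := [Choice of freemod by <:].
HB.instance Definition _ := [SubChoice_isSubLmodule of freemod by <:].

Lemma freemod_gen_subproof (x : X) : (fun y => (y == x)%:R) \in finsupp.
Proof.
apply/asboolP; exists [:: x] => y; rewrite mem_seq1.
by case: (y == x); rewrite ?eqxx.
Qed.

Definition freemod_gen x : freemod := Freemod (freemod_gen_subproof x).

Lemma freemod_supp (phi psi : freemod) :
  exists2 s : seq X, uniq s & forall x, x \notin s -> phi x = 0 /\ psi x = 0.
Proof.
case: phi => phi /= /asboolP[s Hs]; case: psi => psi /= /asboolP[t Ht].
exists (undup (s ++ t)); first exact: undup_uniq.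
move=> x; rewrite mem_undup mem_cat negb_or => /andP[xs xt].
by split; apply/eqP; [apply: contraNT xs => /Hs|apply: contraNT xt => /Ht].
Qed.

Section Lift.
Variables (M : lmodType R) (g : X -> M).

Definition freemod_lift (phi : freemod) : M :=
  \sum_(x \in [set: X]) (phi x : R) *: g x.

Lemma freemod_liftE (s : seq X) (phi : freemod) :
    uniq s -> (forall x, x \notin s -> phi x = 0) ->
  freemod_lift phi = \sum_(x <- s) (phi x : R) *: g x.
Proof.
move=> us Hs; rewrite /freemod_lift (fsbigE s) //.
  by apply: eq_bigl => x; rewrite in_setT.
by move=> x _ /Hs ->; rewrite scale0r.
Qed.

Lemma freemod_lift_linear : linear freemod_lift.
Proof.
move=> a phi psi; have [s us Hs] := freemod_supp phi psi.
rewrite !(freemod_liftE us); try by move=> x /Hs[].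
  rewrite scaler_sumr -big_split /=; apply: eq_bigr => x _.
  by rewrite -[X in X *: _]/(a * phi x + psi x) scalerDl scalerA.
move=> x /Hs[p0 q0]; rewrite -[LHS]/(a * phi x + psi x).
by rewrite p0 q0 mulr0 addr0.
Qed.

HB.instance Definition _ :=
  GRing.isLinear.Build R freemod M _ freemod_lift freemod_lift_linear.

Lemma freemod_lift_gen x : freemod_lift (freemod_gen x) = g x.
Proof.
rewrite (@freemod_liftE [:: x]) //; first by rewrite big_seq1 /= eqxx scale1r.
by move=> y; rewrite mem_seq1 /= => /negbTE ->.
Qed.

End Lift.

Lemma freemod_ext (M : lmodType R) (f g : {linear freemod -> M}) :
  (forall x, f (freemod_gen x) = g (freemod_gen x)) -> f =1 g.
Proof.
move=> fg phi; have [s us Hs] := freemod_supp phi phi.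
have -> : phi = \sum_(x <- s) (phi x : R) *: freemod_gen x.
  apply/val_inj; rewrite raddf_sum; apply/funext => y /=; rewrite fct_sumE.
  have [ys|ys] := boolP (y \in s).
    rewrite (bigD1_seq y) //= big1 ?addr0 => [|x xy].
      by rewrite -[RHS]/(phi y * (y == y)%:R) eqxx mulr1.
    rewrite -[LHS]/(phi x * (y == x)%:R).
    by rewrite eq_sym (negbTE xy) mulr0.
  rewrite (Hs _ ys).1 big_seq big1 // => x xs.
  rewrite -[LHS]/(phi x * (y == x)%:R).
  by rewrite eq_sym (negbTE (memPn ys x xs)) mulr0.
by rewrite !linear_sum; apply: eq_bigr => x _; rewrite !linearZ /= fg.
Qed.

End FreeModule.

Local Notation "M ^z" := (zmodule M) (at level 2, format "M ^z") : type_scope.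

Section Tensor.
Variables (R : pzRingType) (A : lmodType R^c) (M : lmodType R).

Let F := freemod int (A * M)%type.
Let gen (a : A) (m : M) : F := freemod_gen int (a, m).

(* A right [R]-module is an [lmodType] over the converse ring [R^c]:
   [(r : R^c) *: a] stands for [a r]. *)
Inductive tensor_rel : F -> Prop :=
| TensorDl a a' m : tensor_rel (gen (a + a') m - gen a m - gen a' m)
| TensorDr a m m' : tensor_rel (gen a (m + m') - gen a m - gen a m')
| TensorM a (r : R) m : tensor_rel (gen ((r : R^c) *: a) m - gen a (r *: m)).

(* The subgroup generated by [tensor_rel]. *)
Definition tensor_null : {pred F} := fun v =>
  `[< forall P : F -> Prop, P 0 -> (forall x y, P x -> P y -> P (x - y)) ->
      (forall x, tensor_rel x -> P x) -> P v >].

Lemma tensor_null_closed : zmod_closed tensor_null.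
Proof.
split=> [|x y]; rewrite !unfold_in; first by apply/asboolP => P P0.
move=> /asboolP Hx /asboolP Hy; apply/asboolP => P P0 PB Prel.
by apply: (PB); [apply: Hx|apply: Hy].
Qed.

HB.instance Definition _ :=
  GRing.isZmodClosed.Build F tensor_null tensor_null_closed.

Local Notation quot := (Quotient.quot tensor_null).

Definition tensor : zmodType := quot.

Definition tens (a : A) (m : M) : tensor := \pi_quot (gen a m).

Lemma tensor_eq (x y : F) :
  tensor_rel (x - y) -> \pi_quot x = \pi_quot y.
Proof.
move=> xy; apply/eqP; rewrite -(Quotient.idealrBE tensor_null) unfold_in.
by apply/asboolP => P _ _; apply.
Qed.

Lemma tensDl a a' m : tens (a + a') m = tens a m + tens a' m.
Proof.
rewrite -[RHS](raddfD \pi_quot); apply: tensor_eq.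
by rewrite opprD addrA; exact: TensorDl.
Qed.

Lemma tensDr a m m' : tens a (m + m') = tens a m + tens a m'.
Proof.
rewrite -[RHS](raddfD \pi_quot); apply: tensor_eq.
by rewrite opprD addrA; exact: TensorDr.
Qed.

Lemma tensM a (r : R) m : tens ((r : R^c) *: a) m = tens a (r *: m).
Proof. by apply: tensor_eq; exact: TensorM. Qed.

Lemma tensor_ext (Z : zmodType) (f g : {additive tensor -> Z}) :
  (forall a m, f (tens a m) = g (tens a m)) -> f =1 g.
Proof.
move=> fg t; rewrite -[t]reprK; move: (repr t) => v.
pose lin (h : {additive tensor -> Z}) (v : F) : Z^z := h (\pi_quot v).
have lin_linear h : linear (lin h).
  move=> n x y; rewrite /lin !raddfD /=; congr (_ + _).
  have -> : n *: x = x *~ n by rewrite -scaler_int intz.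
  by rewrite !raddfMz.
pose L h := HB.pack_for {linear F -> Z^z} (lin h)
  (GRing.isLinear.Build int F Z^z _ (lin h) (lin_linear h)).
by apply: (freemod_ext (f := L f) (g := L g)) => -[a m]; exact: fg.
Qed.

Section Lift.
Variable Z : zmodType.

Record balanced (b : A -> M -> Z) : Prop := Balanced {
  balancedDl a a' m : b (a + a') m = b a m + b a' m;
  balancedDr a m m' : b a (m + m') = b a m + b a m';
  balancedM a (r : R) m : b ((r : R^c) *: a) m = b a (r *: m) }.

Variable b : A -> M -> Z.

Definition tensor_lift & balanced b := fun t : tensor =>
  freemod_lift (M := Z^z) (fun am => b am.1 am.2) (repr t) : Z.

Variable hb : balanced b.

Lemma tensor_lift_pi v :
  tensor_lift hb (\pi_quot v) =
  freemod_lift (M := Z^z) (fun am => b am.1 am.2) v.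
Proof.
rewrite /tensor_lift.
pose L : {linear F -> Z^z} := freemod_lift (M := Z^z) (fun am => b am.1 am.2).
rewrite -[LHS]/(L (repr (\pi_quot v))) -[RHS]/(L v).
apply: subr0_eq; rewrite -raddfB.
have : repr (\pi_quot v) - v \in tensor_null.
  by rewrite Quotient.idealrBE reprK.
rewrite unfold_in => /asboolP/(_ (fun w => L w = 0)); apply.
  by rewrite raddf0.
  by move=> x y fx fy; rewrite raddfB /= fx fy subr0.
move=> _ [a a' m|a m m'|a r m]; rewrite !raddfB /= !freemod_lift_gen /=.
- by rewrite (balancedDl hb) -addrA -opprD subrr.
- by rewrite (balancedDr hb) -addrA -opprD subrr.
- by rewrite (balancedM hb) subrr.
Qed.

Lemma tensor_lift_additive : zmod_morphism (tensor_lift hb).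
Proof.
move=> x y; rewrite -[x]reprK -[y]reprK -(raddfB \pi_quot) !tensor_lift_pi.
exact: (raddfB (freemod_lift (M := Z^z) _)).
Qed.

HB.instance Definition _ :=
  GRing.isZmodMorphism.Build tensor Z (tensor_lift hb) tensor_lift_additive.

Lemma tensor_liftE a m : tensor_lift hb (tens a m) = b a m.
Proof. by rewrite tensor_lift_pi freemod_lift_gen. Qed.

End Lift.
End Tensor.

Arguments tens {R A M}.

Section TensorMap.
Variable R : pzRingType.

Lemma tensor_map_balanced (A A' : lmodType R^c) (M M' : lmodType R)
    (f : {linear A -> A'}) (g : {linear M -> M'}) :
  balanced (fun a m => tens (f a) (g m)).
Proof.
by split=> *; rewrite ?linearD ?linearZ /= ?(tensDl, tensDr) ?tensM.
Qed.

Definition tensor_map (A A' : lmodType R^c) (M M' : lmodType R)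
    (f : {linear A -> A'}) (g : {linear M -> M'}) :
    {additive tensor A M -> tensor A' M'} :=
  tensor_lift (tensor_map_balanced f g).

End TensorMap.

Section Modules.
Variable R : pzRingType.

Definition exact_at (U V : Type) (W : zmodType) (f : U -> V) (g : V -> W) :=
  forall y, g y = 0 <-> exists x, f x = y.

Definition surj (U V : Type) (f : U -> V) := forall y, exists x, f x = y.

Definition isomorphic (M N : lmodType R) :=
  exists f : {linear M -> N}, bijective f.

Definition fin_gen (M : lmodType R) :=
  exists (n : nat) (e : 'I_n -> M),
    forall x, exists a : 'I_n -> R, x = \sum_(i < n) a i *: e i.

Definition projective (P : lmodType R) :=
  forall (U V : lmodType R) (f : {linear U -> V}) (g : {linear P -> V}),
    surj f -> exists h : {linear P -> U}, f \o h =1 g.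

Definition injective_module (I : lmodType R) :=
  forall (U V : lmodType R) (f : {linear U -> V}) (g : {linear U -> I}),
    injective f -> exists h : {linear V -> I}, h \o f =1 g.

Definition flat (F : lmodType R) :=
  forall (A B D : lmodType R^c) (f : {linear A -> B}) (g : {linear B -> D}),
    exact_at f g ->
    exact_at (tensor_map f (@idfun F)) (tensor_map g (@idfun F)).

Lemma freemod_projective (X : choiceType) : projective (freemod R X).
Proof.
move=> U V f g sf; have /choice[u fu] := fun x => sf (g (freemod_gen R x)).
exists (freemod_lift u); apply: (freemod_ext (f := f \o freemod_lift u)) => x.
by rewrite /= freemod_lift_gen fu.
Qed.

End Modules.

Section Resolution.
Variable R : pzRingType.

Record proj_res (M : lmodType R) := ProjRes {
  res_ob :> nat -> lmodType R;
  res_diff n : {linear res_ob n.+1 -> res_ob n};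
  res_aug : {linear res_ob 0 -> M};
  res_projective n : projective (res_ob n);
  res_aug_surj : surj res_aug;
  res_exact0 : exact_at (res_diff 0) res_aug;
  res_exactS n : exact_at (res_diff n.+1) (res_diff n) }.

Definition finite_proj_res (M : lmodType R) :=
  exists P : proj_res M, forall n, fin_gen (P n).

Record arrow := Arrow { src : lmodType R; tgt : lmodType R;
                        arr : {linear src -> tgt} }.

(* [f : U -> V] is sent to the map [freemod R (ker f) -> U] that extends the
   inclusion of [ker f] in [U]. *)
Definition arrow_step (f : arrow) : arrow :=
  Arrow (freemod_lift (R := R) (@kernel_val _ _ (arr f))).

Definition free_arrow (M : lmodType R) n : arrow :=
  iter n arrow_step (Arrow (freemod_lift (R := R) (@id M))).

Lemma arrow_step_exact f : exact_at (arr (arrow_step f)) (arr f).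
Proof.
move=> y; split=> [fy|[x <-]].
  have ky : y \in ker_pred (arr f) by apply/eqP; exact: fy.
  by exists (freemod_gen R (Kernel ky)); exact: freemod_lift_gen.
apply: (freemod_ext (f := arr f \o arr (arrow_step f)) (g := \0)) x => -[x kx].
by rewrite /= [X in arr f X]freemod_lift_gen; exact/eqP.
Qed.

Lemma free_arrow_projective M n : projective (src (free_arrow M n)).
Proof. by case: n => [|n]; exact: freemod_projective. Qed.

Lemma free_arrow_surj M : surj (arr (free_arrow M 0)).
Proof. by move=> y; exists (freemod_gen R y); exact: freemod_lift_gen. Qed.

(* The standard free resolution
   [... -> R^(ker d_0) -> R^(ker aug) -> R^(M) -> M], where [aug : R^(M) -> M]. *)
Definition free_res (M : lmodType R) : proj_res M := @ProjRes M
  (fun n => src (free_arrow M n)) (fun n => arr (free_arrow M n.+1))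
  (arr (free_arrow M 0)) (@free_arrow_projective M) (@free_arrow_surj M)
  (@arrow_step_exact _) (fun n => @arrow_step_exact _).

End Resolution.

Definition Hom (R : pzRingType) (U V : lmodType R) : Type := {linear U -> V}.

Section HomGroup.
Variables (R : pzRingType) (U V : lmodType R).
Implicit Types f g h : Hom U V.

HB.instance Definition _ := gen_eqMixin (Hom U V).
HB.instance Definition _ := gen_choiceMixin (Hom U V).

Definition hom_zero : Hom U V := \0.
Definition hom_opp f : Hom U V := \- (f : {linear U -> V}).
Definition hom_add f g : Hom U V :=
  (f : {linear U -> V}) \+ (g : {linear U -> V}).

Lemma hom_addA : associative hom_add.
Proof. by move=> f g h; apply: linear_ext => x /=; rewrite addrA. Qed.

Lemma hom_addC : commutative hom_add.
Proof. by move=> f g; apply: linear_ext => x /=; rewrite addrC. Qed.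

Lemma hom_add0 : left_id hom_zero hom_add.
Proof. by move=> f; apply: linear_ext => x /=; rewrite add0r. Qed.

Lemma hom_addN : left_inverse hom_zero hom_opp hom_add.
Proof. by move=> f; apply: linear_ext => x /=; rewrite addNr. Qed.

HB.instance Definition _ :=
  GRing.isZmodule.Build (Hom U V) hom_addA hom_addC hom_add0 hom_addN.

End HomGroup.

Section Precomp.
Variables (R : pzRingType) (U V N : lmodType R) (h : {linear U -> V}).

Definition precomp (f : Hom V N) : Hom U N := (f : {linear V -> N}) \o h.

Lemma precomp_additive : zmod_morphism precomp.
Proof. by move=> f g; apply: linear_ext. Qed.

HB.instance Definition _ :=
  GRing.isZmodMorphism.Build (Hom V N) (Hom U N) precomp precomp_additive.

End Precomp.

(* [Ext i M N] is [H^i(Hom(P, N))] and [Tor i A M] is [H_i(P \otimes M)], for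
   [P] the standard free resolution of the first argument. *)
Definition Ext (R : pzRingType) (i : nat) (M N : lmodType R) : zmodType :=
  let P := free_res M in
  let delta n : {additive Hom (P n) N -> Hom (P n.+1) N} :=
    precomp (res_diff P n) in
  if i is j.+1 then homology (delta j) (delta j.+1)
  else homology (\0 : {additive Hom (P 0) N -> Hom (P 0) N}) (delta 0).

Definition Tor (R : pzRingType) (i : nat) (A : lmodType R^c) (M : lmodType R) :
    zmodType :=
  let P := free_res A in
  let d n : {additive tensor (P n.+1) M -> tensor (P n) M} :=
    tensor_map (res_diff P n) (@idfun M) in
  if i is j.+1 then homology (d j.+1) (d j)
  else homology (d 0) (\0 : {additive tensor (P 0) M -> tensor (P 0) M}).

Definition trivial_group (Z : zmodType) := forall z : Z, z = 0.

HB.mixin Record Lmodule_isBimodule (S R : pzRingType) C of GRing.Lmodule S C := {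
  ract : C -> R -> C;
  ractA : forall x r r', ract (ract x r) r' = ract x (r * r');
  ract1 : forall x, ract x 1 = x;
  ractDl : forall x y r, ract (x + y) r = ract x r + ract y r;
  ractDr : forall x r r', ract x (r + r') = ract x r + ract x r';
  ractZ : forall (s : S) x r, ract (s *: x) r = s *: ract x r }.

#[short(type="bimodType")]
HB.structure Definition Bimodule (S R : pzRingType) :=
  { C of GRing.Lmodule S C & Lmodule_isBimodule S R C }.

(* [C] as a right [R]-module. *)
Definition right_mod (S R : pzRingType) (C : bimodType S R) : Type := C.

Section RightModule.
Variables (S R : pzRingType) (C : bimodType S R).

HB.instance Definition _ := GRing.Zmodule.on (right_mod C).

Definition right_scale (r : R^c) (x : right_mod C) : right_mod C :=
  @ract S R C x r.

Lemma right_scaleA a b x :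
  right_scale a (right_scale b x) = right_scale (a * b) x.
Proof. exact: ractA. Qed.

Lemma right_scale1 : left_id 1 right_scale.
Proof. exact: ract1. Qed.

Lemma right_scaleDr : right_distributive right_scale +%R.
Proof. by move=> r x y; exact: ractDl. Qed.

Lemma right_scaleDl x : {morph right_scale^~ x : a b / a + b}.
Proof. by move=> a b; exact: ractDr. Qed.

HB.instance Definition _ := GRing.Zmodule_isLmodule.Build R^c (right_mod C)
  right_scaleA right_scale1 right_scaleDr right_scaleDl.

Definition left_mul (s : S) : right_mod C -> right_mod C :=
  fun x => s *: (x : C).

Lemma left_mul_linear s : linear (left_mul s).
Proof.
move=> r x y; rewrite /left_mul [LHS]scalerDr; congr (_ + _).
exact/esym/ractZ.
Qed.

HB.instance Definition _ s :=
  GRing.isLinear.Build R^c (right_mod C) (right_mod C) _ (left_mul s)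
    (left_mul_linear s).

Definition right_mul (r : R) : C -> C := fun x => ract x r.

Lemma right_mul_linear r : linear (right_mul r).
Proof. by move=> s x y; rewrite /right_mul ractDl ractZ. Qed.

HB.instance Definition _ r :=
  GRing.isLinear.Build S C C _ (right_mul r) (right_mul_linear r).

Definition homothetyS (s : S) : Hom (right_mod C) (right_mod C) := left_mul s.
Definition homothetyR (r : R) : Hom C C := right_mul r.

(* The homothety maps are homomorphisms, so being an isomorphism means being
   bijective; likewise for the linear maps [mu] and [nu] below. *)
Record semidualizing : Prop := Semidualizing {
  sd_a1 : finite_proj_res C;
  sd_a2 : finite_proj_res (right_mod C);
  sd_b1 : bijective homothetyS;
  sd_b2 : bijective homothetyR;
  sd_c1 : forall i, (1 <= i)%N -> trivial_group (Ext i C C);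
  sd_c2 : forall i, (1 <= i)%N ->
            trivial_group (Ext i (right_mod C) (right_mod C)) }.

End RightModule.

Section HomModule.
Variables (S R : pzRingType) (C : bimodType S R) (N : lmodType S).

(* The left [R]-module [Hom_S(C, N)], with [(r f)(c) = f (c r)]. *)
Definition hom_scale (r : R) (f : Hom C N) : Hom C N :=
  precomp (@right_mul S R C r) f.

Lemma hom_scaleA a b f : hom_scale a (hom_scale b f) = hom_scale (a * b) f.
Proof. by apply: linear_ext => x /=; rewrite /right_mul ractA. Qed.

Lemma hom_scale1 : left_id 1 hom_scale.
Proof. by move=> f; apply: linear_ext => x /=; rewrite /right_mul ract1. Qed.

Lemma hom_scaleDr : right_distributive hom_scale +%R.
Proof. by move=> r f g; apply: linear_ext. Qed.

Lemma hom_scaleDl f : {morph hom_scale^~ f : a b / a + b}.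
Proof.
by move=> a b; apply: linear_ext => x /=; rewrite /right_mul ractDr linearD.
Qed.

Definition bihom : Type := Hom C N.

HB.instance Definition _ := GRing.Zmodule.on bihom.
HB.instance Definition _ := GRing.Zmodule_isLmodule.Build R bihom
  hom_scaleA hom_scale1 hom_scaleDr hom_scaleDl.

End HomModule.

Section TensorModule.
Variables (S R : pzRingType) (C : bimodType S R) (M : lmodType R).

(* The left [S]-module [C \otimes_R M]. *)
Definition bitensor : Type := tensor (right_mod C) M.

HB.instance Definition _ := GRing.Zmodule.on bitensor.

Definition bitens (c : C) (m : M) : bitensor := tens (c : right_mod C) m.

Definition bitensor_scale (s : S) : bitensor -> bitensor :=
  tensor_map (@left_mul S R C s) (@idfun M).

Lemma bitensor_scaleE s c m : bitensor_scale s (bitens c m) = bitens (s *: c) m.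
Proof. exact: tensor_liftE. Qed.

HB.instance Definition _ s := GRing.Additive.copy (bitensor_scale s)
  (tensor_map (@left_mul S R C s) (@idfun M)).

Lemma bitensor_ext (Z : zmodType) (f g : {additive bitensor -> Z}) :
  (forall c m, f (bitens c m) = g (bitens c m)) -> f =1 g.
Proof. exact: (@tensor_ext R (right_mod C) M). Qed.

Lemma bitensor_scaleA a b t :
  bitensor_scale a (bitensor_scale b t) = bitensor_scale (a * b) t.
Proof.
apply: (bitensor_ext (f := bitensor_scale a \o bitensor_scale b)) t => c m.
by rewrite /= !bitensor_scaleE scalerA.
Qed.

Lemma bitensor_scale1 : left_id 1 bitensor_scale.
Proof.
apply: (bitensor_ext (g := idfun)) => c m.
by rewrite [LHS]bitensor_scaleE scale1r.
Qed.

Lemma bitensor_scaleDr : right_distributive bitensor_scale +%R.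
Proof. by move=> s; exact: raddfD. Qed.

Lemma bitensor_scaleDl t : {morph bitensor_scale^~ t : a b / a + b}.
Proof.
move=> a b.
apply: (bitensor_ext (g := bitensor_scale a \+ bitensor_scale b)) t => c m.
by rewrite /= !bitensor_scaleE scalerDl; exact: tensDl.
Qed.

HB.instance Definition _ := GRing.Zmodule_isLmodule.Build S bitensor
  bitensor_scaleA bitensor_scale1 bitensor_scaleDr bitensor_scaleDl.

End TensorModule.

Section TensorHomMaps.
Variables (S R : pzRingType) (C : bimodType S R).

Section TensorFunctor.
Variables (M M' : lmodType R) (f : {linear M -> M'}).

Definition bitensor_map : bitensor C M -> bitensor C M' :=
  tensor_map (@idfun (right_mod C)) f.

HB.instance Definition _ := GRing.Additive.copy bitensor_map
  (tensor_map (@idfun (right_mod C)) f).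

Lemma bitensor_mapE c m : bitensor_map (bitens c m) = bitens c (f m).
Proof. exact: tensor_liftE. Qed.

Lemma bitensor_map_scalable : scalable bitensor_map.
Proof.
move=> s t.
apply: (bitensor_ext (f := bitensor_map \o bitensor_scale s)
  (g := bitensor_scale s \o bitensor_map)) t => c m.
by rewrite /= bitensor_scaleE !bitensor_mapE bitensor_scaleE.
Qed.

HB.instance Definition _ :=
  GRing.isScalable.Build S (bitensor C M) (bitensor C M') _ bitensor_map
    bitensor_map_scalable.

End TensorFunctor.

Section HomFunctor.
Variables (N N' : lmodType S) (g : {linear N -> N'}).

Definition bihom_map : bihom C N -> bihom C N' :=
  fun h => g \o (h : {linear C -> N}).

Lemma bihom_map_linear : linear bihom_map.
Proof. by move=> r f h; apply: linear_ext => x /=; rewrite linearD. Qed.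

HB.instance Definition _ :=
  GRing.isLinear.Build R (bihom C N) (bihom C N') _ bihom_map bihom_map_linear.

End HomFunctor.

Section Mu.
Variable M : lmodType R.

Definition bitensr (m : M) : C -> bitensor C M := fun c => bitens c m.

Lemma bitensr_linear m : linear (bitensr m).
Proof.
by move=> s c c'; rewrite [LHS]tensDl; congr (_ + _); exact/esym/bitensor_scaleE.
Qed.

HB.instance Definition _ m :=
  GRing.isLinear.Build S C (bitensor C M) _ (bitensr m) (bitensr_linear m).

(* m |-> (c |-> c \otimes m) *)
Definition mu (m : M) : bihom C (bitensor C M) := bitensr m.

Lemma mu_linear : linear mu.
Proof.
move=> r m m'; apply: linear_ext => c /=.
by rewrite [LHS]tensDr; congr (_ + _); exact/esym/tensM.
Qed.

HB.instance Definition _ :=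
  GRing.isLinear.Build R M (bihom C (bitensor C M)) _ mu mu_linear.

End Mu.

Section Nu.
Variable N : lmodType S.

Lemma nu_balanced : balanced
  (fun (c : right_mod C) (f : bihom C N) => (f : {linear C -> N}) (c : C)).
Proof. by split=> // a a' m; exact: linearD. Qed.

(* c \otimes f |-> f c *)
Definition nu : bitensor C (bihom C N) -> N := tensor_lift nu_balanced.

HB.instance Definition _ := GRing.Additive.copy nu (tensor_lift nu_balanced).

Lemma nuE c (f : bihom C N) : nu (bitens c f) = (f : {linear C -> N}) c.
Proof. exact: tensor_liftE. Qed.

Lemma nu_scalable : scalable nu.
Proof.
move=> s t.
apply: (bitensor_ext (f := nu \o bitensor_scale s) (g := ( *:%R s) \o nu)) t.
by move=> c f; rewrite /= bitensor_scaleE !nuE linearZ.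
Qed.

HB.instance Definition _ :=
  GRing.isScalable.Build S (bitensor C (bihom C N)) N _ nu nu_scalable.

End Nu.

Record Auslander (M : lmodType R) : Prop := AuslanderClass {
  auslander1 : forall i, (1 <= i)%N -> trivial_group (Tor i (right_mod C) M);
  auslander2 : forall i, (1 <= i)%N -> trivial_group (Ext i C (bitensor C M));
  auslander3 : bijective (@mu M) }.

Record Bass (N : lmodType S) : Prop := BassClass {
  bass1 : forall i, (1 <= i)%N -> trivial_group (Ext i C N);
  bass2 : forall i, (1 <= i)%N ->
            trivial_group (Tor i (right_mod C) (bihom C N));
  bass3 : bijective (@nu N) }.

Definition C_flat (N : lmodType S) :=
  exists2 F : lmodType R, flat F & isomorphic N (bitensor C F).

Definition C_projective (N : lmodType S) :=
  exists2 P : lmodType R, projective P & isomorphic N (bitensor C P).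

Definition C_injective (M : lmodType R) :=
  exists2 I : lmodType S, injective_module I & isomorphic M (bihom C I).

End TensorHomMaps.

Record category := Category {
  cat_ob :> Type;
  cat_hom : cat_ob -> cat_ob -> Type;
  cat_id a : cat_hom a a;
  cat_comp a b c : cat_hom b c -> cat_hom a b -> cat_hom a c;
  cat_idl a b (f : cat_hom a b) : cat_comp (cat_id b) f = f;
  cat_idr a b (f : cat_hom a b) : cat_comp f (cat_id a) = f;
  cat_assoc a b c d (f : cat_hom c d) (g : cat_hom b c) (h : cat_hom a b) :
    cat_comp f (cat_comp g h) = cat_comp (cat_comp f g) h }.

Record functor (X Y : category) := Functor {
  fun_ob :> X -> Y;
  fun_hom a b : cat_hom a b -> cat_hom (fun_ob a) (fun_ob b);
  fun_id a : fun_hom (cat_id a) = cat_id (fun_ob a);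
  fun_comp a b c (f : cat_hom b c) (g : cat_hom a b) :
    fun_hom (cat_comp f g) = cat_comp (fun_hom f) (fun_hom g) }.

Definition id_functor (X : category) : functor X X :=
  @Functor X X (fun a => a) (fun a b f => f) (fun a => erefl)
    (fun a b c f g => erefl).

Program Definition comp_functor (X Y Z : category)
    (G : functor Y Z) (F : functor X Y) : functor X Z :=
  @Functor X Z (fun a => G (F a)) (fun a b f => fun_hom G (fun_hom F f)) _ _.
Next Obligation. by rewrite !fun_id. Qed.
Next Obligation. by rewrite !fun_comp. Qed.

Record nat_iso (X Y : category) (F G : functor X Y) := NatIso {
  ni_hom a : cat_hom (F a) (G a);
  ni_inv a : cat_hom (G a) (F a);
  ni_natural a b (f : cat_hom a b) :
    cat_comp (ni_hom b) (fun_hom F f) = cat_comp (fun_hom G f) (ni_hom a);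
  ni_homK a : cat_comp (ni_inv a) (ni_hom a) = cat_id (F a);
  ni_invK a : cat_comp (ni_hom a) (ni_inv a) = cat_id (G a) }.

Definition quasi_inverse (X Y : category) (F : functor X Y) (G : functor Y X) :=
  inhabited (nat_iso (id_functor X) (comp_functor G F)) /\
  inhabited (nat_iso (comp_functor F G) (id_functor Y)).

Definition full_subcat (X : category) (P : X -> Prop) : category :=
  @Category {a : X | P a} (fun a b => cat_hom (sval a) (sval b))
    (fun a => cat_id (sval a)) (fun a b c => @cat_comp X _ _ _)
    (fun a b => @cat_idl X _ _) (fun a b => @cat_idr X _ _)
    (fun a b c d => @cat_assoc X _ _ _ _).

Definition restrict (X Y : category) (F : functor X Y)
    (P : X -> Prop) (Q : Y -> Prop) (PQ : forall a, P a -> Q (F a)) :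
    functor (full_subcat P) (full_subcat Q) :=
  @Functor (full_subcat P) (full_subcat Q)
    (fun a => exist Q (F (sval a)) (PQ _ (svalP a)))
    (fun a b f => fun_hom F f) (fun a => fun_id F (sval a))
    (fun a b c => @fun_comp X Y F _ _ _).

(* [F] and [G] restrict to functors between the full subcategories [P] and [Q],
   and the restrictions are quasi-inverse to each other. *)
Definition restrict_to_equivalence (X Y : category)
    (F : functor X Y) (G : functor Y X) (P : X -> Prop) (Q : Y -> Prop) :=
  exists (PQ : forall a, P a -> Q (F a)) (QP : forall b, Q b -> P (G b)),
    quasi_inverse (restrict PQ) (restrict QP).

Program Definition Mod (R : pzRingType) : category :=
  @Category (lmodType R) (fun M N => {linear M -> N}) (fun M => @idfun M)
    (fun M N K f g => f \o g) _ _ _.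
Next Obligation. by apply: linear_ext. Qed.
Next Obligation. by apply: linear_ext. Qed.
Next Obligation. by apply: linear_ext. Qed.

Section Functors.
Variables (S R : pzRingType) (C : bimodType S R).

Lemma bitensor_map_id (M : lmodType R) :
  (bitensor_map (@idfun M) : {linear bitensor C M -> bitensor C M}) = idfun.
Proof.
apply/linear_ext/bitensor_ext => c m; exact: bitensor_mapE.
Qed.

Lemma bitensor_map_comp (M N K : lmodType R)
    (f : {linear N -> K}) (g : {linear M -> N}) :
  (bitensor_map (f \o g) : {linear bitensor C M -> bitensor C K}) =
  bitensor_map f \o bitensor_map g.
Proof. by apply/linear_ext/bitensor_ext => c m; rewrite /= !bitensor_mapE. Qed.

Definition tensor_functor : functor (Mod R) (Mod S) :=
  @Functor (Mod R) (Mod S) (fun M => bitensor C M)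
    (fun M N f => bitensor_map f) bitensor_map_id bitensor_map_comp.

Lemma bihom_map_id (N : lmodType S) :
  (bihom_map (@idfun N) : {linear bihom C N -> bihom C N}) = idfun.
Proof. by apply/linear_ext => f; apply/linear_ext. Qed.

Lemma bihom_map_comp (M N K : lmodType S)
    (f : {linear N -> K}) (g : {linear M -> N}) :
  (bihom_map (f \o g) : {linear bihom C M -> bihom C K}) =
  bihom_map f \o bihom_map g.
Proof. by apply/linear_ext => h; apply/linear_ext. Qed.

Definition hom_functor : functor (Mod S) (Mod R) :=
  @Functor (Mod S) (Mod R) (fun N => bihom C N)
    (fun M N f => bihom_map f) bihom_map_id bihom_map_comp.

End Functors.

(* Main.v *)
(* Replacing the standard free resolutions by degreewise finite ones (any two
   projective resolutions are homotopy equivalent) makes the evaluation maps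
     Hom_S(P, C) (x)_R F -> Hom_S(P, C (x)_R F),
     Q (x)_R Hom_S(C, I) -> Hom_S(Hom_{R^op}(Q, C), I)
   isomorphisms on each term. The complexes 0 -> R -> Hom_S(P, C) and
   0 -> S -> Hom_{R^op}(Q, C) are exact because C is semidualizing; tensoring the
   first with a flat F shows that F is in A_C(R), and applying Hom_S(-, I) to the
   second shows that an injective I is in B_C(S). By the triangle
   identities the two functors exchange A_C(R) and B_C(S), and everything else
   follows by transport along isomorphisms. *)

From HB Require Import structures.
From mathcomp Require Import all_boot all_algebra generic_quotient ring_quotient.
From mathcomp Require Import boolp.
Require Import Defs.

Set Implicit Arguments.
Unset Strict Implicit.
Unset Printing Implicit Defensive.

Import GRing.Theory.
Local Open Scope ring_scope.
Local Open Scope quotient_scope.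

(** * Independence of Ext and Tor vanishing from the resolution *)

(** A class in the quotient vanishes exactly when its representative is a boundary. The vanishing of
    [Ext] and [Tor] is reached only through this elementwise form. *)
Lemma homology_trivial (A B D : zmodType)
    (f : {additive A -> B}) (g : {additive B -> D}) :
  trivial_group (homology f g) <->
  forall b, g b = 0 -> exists a, f a = b.
Proof.
split=> [H b gb|H z].
  have kb : b \in ker_pred g by apply/eqP.
  have := H (\pi_(Quotient.quot (@boundary _ _ _ f g)) (Kernel kb)).
  rewrite -[RHS](raddf0 \pi_(Quotient.quot (@boundary _ _ _ f g))) => /eqP.
  by rewrite -(Quotient.idealrBE (@boundary _ _ _ f g)) subr0 => /asboolP.
rewrite -[z]reprK -[RHS](raddf0 \pi_(Quotient.quot (@boundary _ _ _ f g))); apply/eqP.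
rewrite -(Quotient.idealrBE (@boundary _ _ _ f g)) subr0; apply/asboolP.
by apply: H; case: (repr z) => x kx; exact/eqP.
Qed.

(** The identity of [P] lifts through the canonical surjection from the free module on the elements
    of [P]. *)
Lemma proj_section (R : pzRingType) (P : lmodType R) : projective P ->
  exists s : {linear P -> freemod R P},
    freemod_lift (R := R) (@id P) \o s =1 @idfun P.
Proof.
apply=> y; exists (freemod_gen R y); exact: freemod_lift_gen.
Qed.

(* Only generators of the free module on [P] are lifted, which avoids
   corestricting [f] to the image of [u]. *)
Lemma proj_lift (R : pzRingType) (P A B : lmodType R)
    (f : {linear A -> B}) (u : {linear P -> B}) :
  projective P -> (forall x, exists y, f y = u x) ->
  exists v : {linear P -> A}, forall x, f (v x) = u x.
Proof.
move=> pP /choice[a fa]; have [s sK] := proj_section pP.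
exists (freemod_lift a \o s) => x /=.
rewrite -[in RHS](sK x : _ = x) /=; move: (s x) => y.
apply: (freemod_ext (f := f \o freemod_lift a)
  (g := u \o freemod_lift (R := R) (@id P))) => {}x.
by rewrite /= !freemod_lift_gen.
Qed.

(** Dependent choice for types that vary with [n]. The invariant [I] travels with each term in a
    sigma type, since a successor is provided only for terms that satisfy it. *)
Lemma dependent_sequence (T : nat -> Type) (I : forall n, T n -> Prop)
    (r : forall n, T n -> T n.+1 -> Prop) (x0 : T 0) :
  I 0 x0 -> (forall n x, I n x -> exists y, r n x y /\ I n.+1 y) ->
  exists2 f : forall n, T n, f 0 = x0 & forall n, r n (f n) (f n.+1).
Proof.
move=> I0 step; pose U n := {x : T n | I n x}.
have next n (x : U n) : {y : U n.+1 | r n (sval x) (sval y)}.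
  by have [y [ry Iy]] := cid (step n _ (svalP x)); exists (exist _ y Iy).
pose F := fix F n : U n :=
  if n is m.+1 then sval (next m (F m)) else exist _ x0 I0.
exists (fun n => sval (F n)) => // n; exact: svalP (next n (F n)).
Qed.

(** * Comparison of projective resolutions *)

Section Comparison.
Variables (R : pzRingType) (M : lmodType R).

Lemma res_diff_diff (Q : proj_res M) n x :
  res_diff Q n (res_diff Q n.+1 x) = 0.
Proof. by apply/res_exactS; exists x. Qed.

Lemma res_aug_diff (Q : proj_res M) x : res_aug Q (res_diff Q 0 x) = 0.
Proof. by apply/res_exact0; exists x. Qed.

(** The identity of [M] is lifted degree by degree. The invariant is that [f n] sends boundaries of
    [P] to boundaries of [Q], which is what the next lift by projectivity requires. *)
Lemma chain_map_exists (P Q : proj_res M) :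
  exists f : forall n, {linear P n -> Q n},
    (forall x, res_aug Q (f 0 x) = res_aug P x) /\
    forall n x, res_diff Q n (f n.+1 x) = f n (res_diff P n x).
Proof.
have [f0 f0P] : exists f0 : {linear P 0 -> Q 0},
    forall x, res_aug Q (f0 x) = res_aug P x.
  by apply: (proj_lift (@res_projective _ _ P 0)) => x; exact: res_aug_surj.
have [||f f0E fP] := @dependent_sequence (fun n => {linear P n -> Q n})
  (fun n f => forall x, exists y, res_diff Q n y = f (res_diff P n x))
  (fun n f f' => forall x, res_diff Q n (f' x) = f (res_diff P n x)) f0.
- by move=> x; apply/res_exact0; rewrite f0P res_aug_diff.
- move=> n f If.
  have [f' ff'] := proj_lift (f := res_diff Q n) (u := f \o res_diff P n)
    (@res_projective _ _ P n.+1) If.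
  exists f'; split=> // x; apply/res_exactS.
  by rewrite ff' /= res_diff_diff raddf0.
- by exists f; rewrite f0E.
Qed.

(** A chain map over the zero map of [M] is null-homotopic: at each stage [k n.+1 - h n \o d] has
    values in cycles, hence in boundaries, and lifts. The formula is recorded in positive degrees,
    where the vanishing of Ext and Tor is tested. *)
Lemma null_homotopic (Q : proj_res M) (k : forall n, {linear Q n -> Q n}) :
  (forall x, res_aug Q (k 0 x) = 0) ->
  (forall n x, res_diff Q n (k n.+1 x) = k n (res_diff Q n x)) ->
  exists h : forall n, {linear Q n -> Q n.+1}, forall n x,
    k n.+1 x = res_diff Q n.+1 (h n.+1 x) + h n (res_diff Q n x).
Proof.
move=> k0 kd; have [h0 h0P] : exists h0 : {linear Q 0 -> Q 1},
    forall x, res_diff Q 0 (h0 x) = k 0 x.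
  by apply: (proj_lift (@res_projective _ _ Q 0)) => x; exact/res_exact0.
have [||h _ hP] := @dependent_sequence (fun n => {linear Q n -> Q n.+1})
  (fun n h => forall x, exists y,
     res_diff Q n.+1 y = k n.+1 x - h (res_diff Q n x))
  (fun n h h' => forall x,
     res_diff Q n.+1 (h' x) = k n.+1 x - h (res_diff Q n x)) h0.
- by move=> x; apply/res_exactS; rewrite raddfB /= kd h0P subrr.
- move=> n h Ih.
  have [h' hh'] := proj_lift (f := res_diff Q n.+1)
    (u := k n.+1 \- (h \o res_diff Q n)) (@res_projective _ _ Q n.+1) Ih.
  exists h'; split=> // x; apply/res_exactS.
  by rewrite raddfB /= kd hh' /= res_diff_diff raddf0 subr0 subrr.
- by exists h => n x; rewrite hP subrK.
Qed.

(** [f \o g - id] lifts the zero map of [M], hence is null-homotopic. The homotopy lives on [Q], the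
    resolution to which acyclicity is to be carried. *)
Lemma comparison (P Q : proj_res M) :
  exists (f : forall n, {linear P n -> Q n}) (g : forall n, {linear Q n -> P n})
    (h : forall n, {linear Q n -> Q n.+1}),
  [/\ forall n x, res_diff Q n (f n.+1 x) = f n (res_diff P n x),
      forall n x, res_diff P n (g n.+1 x) = g n (res_diff Q n x) &
      forall n x, f n.+1 (g n.+1 x) =
        x + res_diff Q n.+1 (h n.+1 x) + h n (res_diff Q n x)].
Proof.
have [f [f0 fd]] := chain_map_exists P Q.
have [g [g0 gd]] := chain_map_exists Q P.
have [|n x|h hP] := @null_homotopic Q (fun n => (f n \o g n) \- idfun).
- by move=> x /=; rewrite raddfB /= f0 g0 subrr.
- by rewrite /= raddfB /= fd gd.
exists f, g, h; split=> // n x.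
by rewrite -addrA -hP /= addrC subrK.
Qed.

End Comparison.

Lemma Hom_congr (R : pzRingType) (U V : lmodType R) (f g : Hom U V) :
  f = g -> (f : {linear U -> V}) =1 (g : {linear U -> V}).
Proof. by move=> ->. Qed.

Lemma tens0l (R : pzRingType) (A : lmodType R^c) (M : lmodType R) (m : M) :
  tens (0 : A) m = 0.
Proof. by apply: (addrI (tens 0 m)); rewrite -tensDl !addr0. Qed.

Lemma tens0r (R : pzRingType) (A : lmodType R^c) (M : lmodType R) (a : A) :
  tens a (0 : M) = 0.
Proof. by apply: (addrI (tens a 0)); rewrite -tensDr !addr0. Qed.

(** * Ext and Tor vanishing as acyclicity, and its transport between resolutions *)

Section Acyclicity.
Variable R : pzRingType.

(** Exactness of Hom(P, N) in positive degrees, for an arbitrary resolution instead of the free one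
    behind [Ext]; [tensor_acyclic] does the same for [Tor]. *)
Definition hom_acyclic (M : lmodType R) (P : proj_res M) (N : lmodType R) :=
  forall n (u : {linear P n.+1 -> N}), (forall x, u (res_diff P n.+1 x) = 0) ->
    exists v : {linear P n -> N}, forall x, v (res_diff P n x) = u x.

Definition tensor_acyclic (A : lmodType R^c) (P : proj_res A) (M : lmodType R) :=
  forall n (t : tensor (P n.+1) M),
    tensor_map (res_diff P n) (@idfun M) t = 0 ->
    exists t', tensor_map (res_diff P n.+1) (@idfun M) t' = t.

Lemma Ext_trivial (M N : lmodType R) :
  (forall i, (1 <= i)%N -> trivial_group (Ext i M N)) <->
  hom_acyclic (free_res M) N.
Proof.
split=> [H n u du|H [|n] // _].
  have /homology_trivial/(_ u)[|v vE] := H n.+1 isT.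
    exact: linear_ext.
  by exists v => x; rewrite -vE.
apply/homology_trivial => u du.
have [|v vE] := H n u; first by move=> x; exact: (Hom_congr du x).
by exists v; apply: linear_ext.
Qed.

Lemma Tor_trivial (A : lmodType R^c) (M : lmodType R) :
  (forall i, (1 <= i)%N -> trivial_group (Tor i A M)) <->
  tensor_acyclic (free_res A) M.
Proof.
split=> [H n|H [|n] // _]; first by apply/homology_trivial; exact: (H n.+1).
by apply/homology_trivial => t dt; exact: H.
Qed.

Lemma hom_acyclic_res (M N : lmodType R) (P Q : proj_res M) :
  hom_acyclic P N -> hom_acyclic Q N.
Proof.
have [f [g [h [fd gd fg]]]] := comparison P Q.
move=> H n u du; have [|v vE] := H n (u \o f n.+1).
  by move=> x; rewrite /= -fd du.
(* Since [v] is a primitive of [u \o f], [v \o g] is one of [u \o f \o g]; the homotopy term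
   corrects it to a primitive of [u]. *)
exists ((v \o g n) \- (u \o h n)) => x /=.
by rewrite -gd vE /= fg !raddfD /= du addr0 addrK.
Qed.

Lemma tensor_map_comp (A B D : lmodType R^c) (M : lmodType R)
    (f : {linear A -> B}) (g : {linear B -> D}) t :
  tensor_map g (@idfun M) (tensor_map f (@idfun M) t) =
  tensor_map (g \o f) (@idfun M) t.
Proof.
apply: (tensor_ext (f := tensor_map g (@idfun M) \o tensor_map f (@idfun M))).
by move=> a m; rewrite /= !tensor_liftE.
Qed.

Lemma tensor_map0 (A B : lmodType R^c) (M : lmodType R)
    (f : {linear A -> B}) t :
  (forall x, f x = 0) -> tensor_map f (@idfun M) t = 0.
Proof.
move=> f0; apply: (tensor_ext (g := \0)) => a m; rewrite [LHS]tensor_liftE f0.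
exact: tens0l.
Qed.

Lemma tensor_acyclic_res (A : lmodType R^c) (M : lmodType R) (P Q : proj_res A) :
  tensor_acyclic P M -> tensor_acyclic Q M.
Proof.
have [f [g [h [fd gd fg]]]] := comparison P Q.
move=> H n t dt.
have [|t' t'E] := H n (tensor_map (g n.+1) idfun t).
  have E : res_diff P n \o g n.+1 = g n \o res_diff Q n :> {linear _ -> _}.
    by apply: linear_ext => x /=; rewrite gd.
  by rewrite tensor_map_comp E -tensor_map_comp dt raddf0.
(* [f t'] bounds [f (g t)], which differs from the cycle [t] by the boundary of [h t]. *)
exists (tensor_map (f n.+2) idfun t' - tensor_map (h n.+1) idfun t).
rewrite raddfB /= !tensor_map_comp.
have E : res_diff Q n.+1 \o f n.+2 = f n.+1 \o res_diff P n.+1 :> {linear _ -> _}.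
  by apply: linear_ext => x /=; rewrite fd.
rewrite E -(tensor_map_comp (res_diff P n.+1) (f n.+1)) t'E tensor_map_comp.
have -> : tensor_map (f n.+1 \o g n.+1) idfun t =
    t + tensor_map (res_diff Q n.+1 \o h n.+1) idfun t +
    tensor_map (h n \o res_diff Q n) idfun t.
  apply: (tensor_ext (g := (idfun \+ tensor_map (res_diff Q n.+1 \o h n.+1) idfun)
    \+ tensor_map (h n \o res_diff Q n) idfun)) => a m.
  by rewrite /= !tensor_liftE /= fg !tensDl.
by rewrite -(tensor_map_comp (res_diff Q n) (h n)) dt raddf0 addr0 addrK.
Qed.

End Acyclicity.

(** * Projective modules: flatness and dual bases *)

(** A representative in the free abelian group is the sum of its coefficients times generators over
    a finite support, so every tensor is a sum of pure ones. *)
Lemma tensor_ind (R : pzRingType) (A : lmodType R^c) (M : lmodType R)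
    (K : tensor A M -> Prop) :
  K 0 -> (forall x y, K x -> K y -> K (x + y)) ->
  (forall a m, K (tens a m)) -> forall t, K t.
Proof.
move=> K0 KD Kt t; rewrite -[t]reprK; move: (repr t) => v.
have [s us Hs] := freemod_supp v v.
have <- : freemod_lift (R := int) (@freemod_gen int (A * M)%type) v = v.
  apply: (freemod_ext (g := idfun)) => x; exact: freemod_lift_gen.
rewrite (freemod_liftE _ us) => [|x /Hs[]//].
rewrite raddf_sum; elim/big_rec: _ => // -[a m] y _; apply: KD.
have -> : (v (a, m) : int) *: freemod_gen int (a, m) =
    freemod_gen int (a, m) *~ v (a, m) by rewrite -scaler_int intz.
rewrite raddfMz /= -[X in X *~ _]/(tens a m).
(* The integer coefficient is absorbed into the left factor, which makes the term a pure tensor. *)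
have -> : tens a m *~ v (a, m) = tens (a *~ v (a, m)) m; last exact: Kt.
have tm_add : zmod_morphism (fun a => tens a m : tensor A M).
  by move=> x z; apply: (addIr (tens z m)); rewrite -tensDl !subrK.
pose h := HB.pack_for {additive A -> tensor A M} (fun a => tens a m : tensor A M)
  (GRing.isZmodMorphism.Build _ _ _ tm_add).
by rewrite -(raddfMz h).
Qed.

Section Coordinates.
Variables (R : pzRingType) (P : lmodType R) (s : {linear P -> freemod R P}).
Hypothesis sK : freemod_lift (R := R) (@id P) \o s =1 @idfun P.

Lemma coord_balanced (A : lmodType R^c) x :
  balanced (fun (a : A) p => ((s p x : R) : R^c) *: a).
Proof.
split=> [a a' p|a p q|a r p]; first exact: scalerDr.
  by rewrite linearD -scalerDl.
by rewrite linearZ scalerA.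
Qed.

(** The elements [x] of [P] and the functionals [p |-> s p x] form a dual basis, possibly infinite.
    This is the functional at [x] tensored with [A]. *)
Definition coord (A : lmodType R^c) x : {additive tensor A P -> A} :=
  tensor_lift (coord_balanced A x).

Lemma coord_map (A B : lmodType R^c) (f : {linear A -> B}) x t :
  coord B x (tensor_map f (@idfun P) t) = f (coord A x t).
Proof.
apply: (tensor_ext (f := coord B x \o tensor_map f (@idfun P))
  (g := f \o coord A x)) => a p.
by rewrite /= !tensor_liftE linearZ.
Qed.

(** Dual basis expansion in the tensor product. Every larger support is allowed as well, so that the
    supports of two summands can be merged. *)
Lemma coord_sum (A : lmodType R^c) (t : tensor A P) : exists S : seq P,
  forall S', uniq S' -> {subset S <= S'} ->
    t = \sum_(x <- S') tens (coord A x t) x.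
Proof.
elim/tensor_ind: t => [|t u [S HS] [T HT]|a p].
- exists [::] => S' _ _; rewrite big1 // => x _.
  by rewrite raddf0 tens0l.
- exists (S ++ T) => S' uS' sub.
  rewrite {1}(HS S') // => [|x xS]; last by rewrite sub // mem_cat xS.
  rewrite {1}(HT S') // => [|x xT]; last by rewrite sub // mem_cat xT orbT.
  by rewrite -big_split; apply: eq_bigr => x _; rewrite raddfD /= tensDl.
have [S uS HS] := freemod_supp (s p) (s p).
exists S => S' uS' sub; rewrite -{1}(sK p : _ = p) /= (freemod_liftE _ uS').
  transitivity (\sum_(x <- S') tens a ((s p x : R) *: x)).
    elim/big_rec2: _ => [|x y z _ <-]; last by rewrite tensDr.
    by rewrite tens0r.
  by apply: eq_bigr => x _; rewrite -tensM /coord /= tensor_liftE.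
by move=> x xS'; case: (HS x) => //; apply: contraNN xS' => /sub.
Qed.

End Coordinates.

Lemma projective_flat (R : pzRingType) (P : lmodType R) : projective P -> flat P.
Proof.
move=> pP A B D f g fg; have [s sK] := proj_section pP => t; split=> [gt|[u <-]].
  have [S HS] := coord_sum sK t.
  (* The coordinates of [t] are killed by [g], hence lift through [f]; the lifts reassemble to a
     preimage of [t]. *)
  have /choice[a fa] : forall x, exists a, f a = coord s B x t.
    by move=> x; apply/fg; rewrite -coord_map gt raddf0.
  exists (\sum_(x <- undup S) tens (a x) x).
  rewrite raddf_sum [RHS](HS (undup S)) ?undup_uniq //; last first.
    by move=> x; rewrite mem_undup.
  by apply: eq_bigr => x _; rewrite /= tensor_liftE fa.
by rewrite tensor_map_comp tensor_map0 // => x /=; apply/fg; exists x.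
Qed.

(** The identity of [P] lifts through a surjection from a free module of finite rank; the [f i] are
    the coordinates of that section. *)
Lemma dual_basis (R : pzRingType) (P : lmodType R) : projective P -> fin_gen P ->
  exists (n : nat) (e : 'I_n -> P) (f : 'I_n -> {linear P -> R^o}),
    forall x, x = \sum_(i < n) (f i x : R) *: e i.
Proof.
move=> pP [n [e eP]].
have [y|s sK] := pP _ _ (freemod_lift e) (@idfun P).
  have [a ->] := eP y; exists (\sum_(i < n) a i *: freemod_gen R i).
  by rewrite linear_sum; apply: eq_bigr => i _; rewrite linearZ /= freemod_lift_gen.
have ev_lin i : linear (fun x => (s x i : R^o)).
  by move=> a x y; rewrite linearP.
exists n, e, (fun i => HB.pack_for {linear P -> R^o} (fun x => (s x i : R^o))
  (GRing.isLinear.Build R P R^o _ _ (ev_lin i))) => x.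
rewrite -{1}(sK x : _ = x) /= (freemod_liftE _ (index_enum_uniq _)) //.
by move=> i; rewrite mem_index_enum.
Qed.

(** * Tensor evaluation *)

Section HomApply.
Variables (R : pzRingType) (U V : lmodType R) (x : U).

(** Evaluation at [x] is made an additive map so that sums of homomorphisms can be evaluated
    termwise. *)
Definition hom_apply (f : Hom U V) : V := (f : {linear U -> V}) x.

Lemma hom_apply_additive : zmod_morphism hom_apply.
Proof. by []. Qed.

HB.instance Definition _ := GRing.isZmodMorphism.Build (Hom U V) V hom_apply
  hom_apply_additive.

End HomApply.

Section RightHomModule.
Variables (S R : pzRingType) (C : bimodType S R) (P : lmodType S).

(** A separate name for Hom_S(P, C), to carry the right [R]-module structure inherited from [C].
    Below, [hom_left] likewise makes Hom_{R^op}(Q, C) a left [S]-module. *)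
Definition hom_right : Type := Hom P C.

HB.instance Definition _ := GRing.Zmodule.on hom_right.

Definition hom_right_scale (r : R^c) (u : hom_right) : hom_right :=
  @right_mul S R C r \o (u : {linear P -> C}).

Lemma hom_right_scaleA a b u :
  hom_right_scale a (hom_right_scale b u) = hom_right_scale (a * b) u.
Proof. by apply: linear_ext => x /=; rewrite /right_mul ractA. Qed.

Lemma hom_right_scale1 : left_id 1 hom_right_scale.
Proof. by move=> u; apply: linear_ext => x /=; rewrite /right_mul ract1. Qed.

Lemma hom_right_scaleDr : right_distributive hom_right_scale +%R.
Proof. by move=> r u v; apply: linear_ext => x /=; rewrite /right_mul ractDl. Qed.

Lemma hom_right_scaleDl u : {morph hom_right_scale^~ u : a b / a + b}.
Proof. by move=> a b; apply: linear_ext => x /=; rewrite /right_mul ractDr. Qed.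

HB.instance Definition _ := GRing.Zmodule_isLmodule.Build R^c hom_right
  hom_right_scaleA hom_right_scale1 hom_right_scaleDr hom_right_scaleDl.

End RightHomModule.

Section RightHomMap.
Variables (S R : pzRingType) (C : bimodType S R) (P P' : lmodType S).
Variable d : {linear P' -> P}.

Definition hom_right_map : hom_right C P -> hom_right C P' := @precomp _ _ _ C d.

Lemma hom_right_map_linear : linear hom_right_map.
Proof. by move=> r u v; apply: linear_ext. Qed.

HB.instance Definition _ := GRing.isLinear.Build R^c _ _ _ hom_right_map
  hom_right_map_linear.

End RightHomMap.

Section TensorEvaluation.
Variables (S R : pzRingType) (C : bimodType S R) (F : lmodType R).

Lemma tensor_eval_balanced (P : lmodType S) :
  balanced (fun (u : hom_right C P) x =>
    (@bitensr S R C F x \o (u : {linear P -> C})) : Hom P (bitensor C F)).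
Proof.
split=> [u v x|u x y|u r x]; apply: linear_ext => p /=.
- exact: tensDl.
- exact: tensDr.
- exact: (@tensM R (right_mod C) F).
Qed.

Definition tensor_eval (P : lmodType S) :
    {additive tensor (hom_right C P) F -> Hom P (bitensor C F)} :=
  tensor_lift (@tensor_eval_balanced P).

Lemma tensor_evalE (P : lmodType S) (u : hom_right C P) x p :
  (tensor_eval P (tens u x) : {linear _ -> _}) p = bitens ((u : {linear P -> C}) p) x.
Proof. by rewrite /tensor_eval /= tensor_liftE. Qed.

Lemma tensor_eval_map (P P' : lmodType S) (d : {linear P' -> P}) t :
  tensor_eval P' (tensor_map (@hom_right_map S R C P P' d) (@idfun F) t) =
  precomp d (tensor_eval P t).
Proof.
apply: (tensor_ext (f := tensor_eval P' \o tensor_map (@hom_right_map S R C P P' d) (@idfun F))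
  (g := precomp d \o tensor_eval P)) => u x.
by rewrite /tensor_eval /= !tensor_liftE; apply: linear_ext.
Qed.

(** With a finite dual basis [e], [f] and [k i c = (p |-> f i p *: c)], the inverse sends [b] to the
    sum over [i] of the image of [b (e i)] under [k i] tensored with [F]. Both cancellations reduce
    to expanding [p] in the dual basis. *)
Lemma tensor_eval_bijective (P : lmodType S) :
  projective P -> fin_gen P -> bijective (tensor_eval P).
Proof.
move=> pP fP; have [n [e [f ef]]] := dual_basis pP fP.
have k_lin i c : linear (fun p => (f i p : S) *: (c : C)).
  by move=> a x y; rewrite linearP scalerDl scalerA.
pose k0 i (c : right_mod C) : hom_right C P :=
  HB.pack_for {linear P -> C} (fun p => (f i p : S) *: (c : C))
    (GRing.isLinear.Build S P C _ _ (k_lin i c)).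
have k0_lin i : linear (k0 i).
  move=> r c c'; apply: linear_ext => p /=; rewrite [LHS]scalerDr.
  by congr (_ + _); exact/esym/ractZ.
pose k i := HB.pack_for {linear right_mod C -> hom_right C P} (k0 i)
  (GRing.isLinear.Build R^c _ _ _ _ (k0_lin i)).
pose inv (b : Hom P (bitensor C F)) : tensor (hom_right C P) F :=
  \sum_(i < n) tensor_map (k i) (@idfun F) ((b : {linear _ -> _}) (e i)).
have kE i t p : (tensor_eval P (tensor_map (k i) (@idfun F) t) : {linear _ -> _}) p
    = (f i p : S) *: (t : bitensor C F).
  apply: (tensor_ext (f := hom_apply p \o (tensor_eval P \o tensor_map (k i) (@idfun F)))
    (g := @bitensor_scale S R C F (f i p))) => c x.
  rewrite /hom_apply /= !tensor_liftE /=.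
  exact/esym/bitensor_scaleE.
exists inv => [t|b].
  have inv_add : zmod_morphism inv.
    move=> b b'; rewrite -sumrB; apply: eq_bigr => i _.
    by rewrite -raddfB.
  pose i0 := HB.pack_for {additive Hom P (bitensor C F) -> tensor (hom_right C P) F} inv
    (GRing.isZmodMorphism.Build _ _ _ inv_add).
  apply: (tensor_ext (f := i0 \o tensor_eval P) (g := idfun)) => u x.
  rewrite /= /inv.
  under eq_bigr do rewrite tensor_evalE [tensor_map _ _ _]tensor_liftE.
  transitivity (tens (\sum_(i < n) k i ((u : {linear _ -> _}) (e i))) x).
    elim/big_rec2: _ => [|i y z _ ->]; last by rewrite tensDl.
    by rewrite tens0l.
  congr tens; apply: linear_ext => p.
  rewrite [in RHS](ef p) linear_sum.
  rewrite -[LHS]/(hom_apply p _) raddf_sum; apply: eq_bigr => i _.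
  by rewrite linearZ.
apply: linear_ext => p; rewrite /inv raddf_sum.
rewrite -[LHS]/(hom_apply p _) raddf_sum [in RHS](ef p) linear_sum.
by apply: eq_bigr => i _; rewrite [RHS](linearZ_LR (b : {linear _ -> _})); exact: kE.
Qed.

End TensorEvaluation.

(** * Hom evaluation *)

Section ImageModule.
Variables (R : pzRingType) (U V : lmodType R).

Definition image_pred (f : {linear U -> V}) : {pred V} :=
  fun y => `[< exists x, f x = y >].

Lemma image_pred_closed f : submod_closed (image_pred f).
Proof.
split=> [|a x y]; rewrite !unfold_in; first by apply/asboolP; exists 0; rewrite raddf0.
move=> /asboolP[u <-] /asboolP[v <-]; apply/asboolP; exists (a *: u + v).
by rewrite linearP.
Qed.

HB.instance Definition _ f :=
  GRing.isSubmodClosed.Build R V (image_pred f) (image_pred_closed f).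

Record image_mod (f : {linear U -> V}) :=
  ImageMod { image_val :> V; _ : image_val \in image_pred f }.

HB.instance Definition _ f := [isSub for @image_val f].
HB.instance Definition _ f := [Choice of image_mod f by <:].
HB.instance Definition _ f := [SubChoice_isSubLmodule of image_mod f by <:].

End ImageModule.

(** [u] is constant on the fibres of [f], so it descends to the image of [f]; injectivity of [I]
    then applies to the inclusion of that image in [V]. *)
Lemma injective_extend (R : pzRingType) (I U V : lmodType R)
    (f : {linear U -> V}) (u : {linear U -> I}) :
  injective_module I -> (forall x, f x = 0 -> u x = 0) ->
  exists v : {linear V -> I}, forall x, v (f x) = u x.
Proof.
move=> iI fu.
have /choice[s sE] : forall y : image_mod f, exists x, f x = val y.
  by case=> y /= /asboolP.
have fuE x x' : f x = f x' -> u x = u x'.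
  by move=> E; apply: subr0_eq; rewrite -raddfB; apply: fu; rewrite linearB E subrr.
have us_lin : linear (u \o s).
  by move=> a y z; rewrite /= -linearP; apply: fuE; rewrite linearP !sE.
have [v vE] := iI _ _ (\val : {linear image_mod f -> V})
  (HB.pack_for {linear image_mod f -> I} (u \o s)
    (GRing.isLinear.Build R _ _ _ _ us_lin)) val_inj.
exists v => x.
have fx : f x \in image_pred f by apply/asboolP; exists x.
by have /= -> := vE (ImageMod fx); apply: fuE; rewrite sE.
Qed.

Section LeftHomModule.
Variables (S R : pzRingType) (C : bimodType S R) (Q : lmodType R^c).

Definition hom_left : Type := Hom Q (right_mod C).

HB.instance Definition _ := GRing.Zmodule.on hom_left.

Definition hom_left_scale (s : S) (u : hom_left) : hom_left :=
  @left_mul S R C s \o (u : {linear Q -> right_mod C}).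

Lemma hom_left_scaleA a b u :
  hom_left_scale a (hom_left_scale b u) = hom_left_scale (a * b) u.
Proof. by apply: linear_ext => x /=; rewrite /left_mul scalerA. Qed.

Lemma hom_left_scale1 : left_id 1 hom_left_scale.
Proof. by move=> u; apply: linear_ext => x /=; rewrite /left_mul scale1r. Qed.

Lemma hom_left_scaleDr : right_distributive hom_left_scale +%R.
Proof. by move=> s u v; apply: linear_ext => x /=; exact: linearD. Qed.

Lemma hom_left_scaleDl u : {morph hom_left_scale^~ u : a b / a + b}.
Proof. by move=> a b; apply: linear_ext => x /=; rewrite /left_mul scalerDl. Qed.

HB.instance Definition _ := GRing.Zmodule_isLmodule.Build S hom_left
  hom_left_scaleA hom_left_scale1 hom_left_scaleDr hom_left_scaleDl.

End LeftHomModule.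

Section LeftHomMap.
Variables (S R : pzRingType) (C : bimodType S R) (Q Q' : lmodType R^c).
Variable d : {linear Q' -> Q}.

Definition hom_left_map : hom_left C Q -> hom_left C Q' :=
  @precomp _ _ _ (right_mod C) d.

Lemma hom_left_map_linear : linear hom_left_map.
Proof. by move=> r u v; apply: linear_ext. Qed.

HB.instance Definition _ := GRing.isLinear.Build S _ _ _ hom_left_map
  hom_left_map_linear.

End LeftHomMap.

Section HomEvaluation.
Variables (S R : pzRingType) (C : bimodType S R) (I : lmodType S).

Definition eval_apply (Q : lmodType R^c) (q : Q) (f : bihom C I) :
    hom_left C Q -> I :=
  fun u => (f : {linear C -> I}) ((u : {linear Q -> right_mod C}) q).

Lemma eval_apply_linear (Q : lmodType R^c) (q : Q) f : linear (eval_apply q f).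
Proof. by move=> s u v; exact: (linearP (f : {linear C -> I})). Qed.

HB.instance Definition _ (Q : lmodType R^c) (q : Q) f :=
  GRing.isLinear.Build S _ _ _ (eval_apply q f) (eval_apply_linear q f).

Definition hom_eval_fun (Q : lmodType R^c) (q : Q) f : Hom (hom_left C Q) I :=
  eval_apply q f.

Lemma hom_eval_balanced (Q : lmodType R^c) : balanced (@hom_eval_fun Q).
Proof.
split=> [q q' f|q f g|q r f]; apply: linear_ext => u //=; rewrite /eval_apply.
  rewrite linearD; exact: (linearD (f : {linear C -> I})).
by rewrite linearZ.
Qed.

Definition hom_eval (Q : lmodType R^c) :
    {additive tensor Q (bihom C I) -> Hom (hom_left C Q) I} :=
  tensor_lift (@hom_eval_balanced Q).

Lemma hom_evalE (Q : lmodType R^c) q f : hom_eval Q (tens q f) = hom_eval_fun q f.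
Proof. exact: tensor_liftE. Qed.

Lemma hom_eval_map (Q Q' : lmodType R^c) (d : {linear Q' -> Q}) t :
  hom_eval Q (tensor_map d (@idfun (bihom C I)) t) =
  precomp (@hom_left_map S R C Q Q' d) (hom_eval Q' t).
Proof.
apply: (tensor_ext (f := hom_eval Q \o tensor_map d (@idfun (bihom C I)))
  (g := precomp (@hom_left_map S R C Q Q' d) \o hom_eval Q')) => q f.
by rewrite /= !tensor_liftE; apply: linear_ext.
Qed.

(** With a finite dual basis [e], [f] and [k i c = (q |-> c (f i q))], the inverse sends [b] to the
    sum of the tensors of [e i] with [b \o k i]. *)
Lemma hom_eval_bijective (Q : lmodType R^c) :
  projective Q -> fin_gen Q -> bijective (hom_eval Q).
Proof.
move=> pQ fQ; have [n [e [f ef]]] := dual_basis pQ fQ.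
have k_lin i (c : C) : linear (fun q => (f i q : R^c) *: (c : right_mod C)).
  by move=> a x y; rewrite linearP scalerDl scalerA.
pose k0 i (c : C) : hom_left C Q :=
  HB.pack_for {linear Q -> right_mod C} (fun q => (f i q : R^c) *: (c : right_mod C))
    (GRing.isLinear.Build R^c Q (right_mod C) _ _ (k_lin i c)).
have k0_lin i : linear (k0 i).
  move=> s c c'; apply: linear_ext => q /=; rewrite [LHS]ractDl.
  by congr (_ + _); exact: ractZ.
pose k i := HB.pack_for {linear C -> hom_left C Q} (k0 i)
  (GRing.isLinear.Build S _ _ _ _ (k0_lin i)).
pose inv (b : Hom (hom_left C Q) I) : tensor Q (bihom C I) :=
  \sum_(i < n) tens (e i) (precomp (k i) b : bihom C I).
exists inv => [t|b].
  have inv_add : zmod_morphism inv.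
    move=> b b'; rewrite -sumrB; apply: eq_bigr => i _; rewrite raddfB.
    by apply: (addIr (tens (e i) (precomp (k i) b' : bihom C I)));
      rewrite -tensDr !subrK.
  pose i0 := HB.pack_for {additive Hom (hom_left C Q) I -> tensor Q (bihom C I)} inv
    (GRing.isZmodMorphism.Build _ _ _ inv_add).
  apply: (tensor_ext (f := i0 \o hom_eval Q) (g := idfun)) => q g.
  rewrite /= /inv; under eq_bigr do rewrite hom_evalE.
  transitivity (tens (\sum_(i < n) (f i q : R^c) *: e i) g); last by rewrite -ef.
  elim/big_rec2: _ => [|i y z _ ->].
    by rewrite tens0l.
  (* The coefficient [f i q] crosses the tensor sign and acts on [g] by [c |-> g (c (f i q))], which
     is evaluation at [q] precomposed with [k i]. *)
  rewrite tensDl; congr (_ + _); rewrite tensM; congr tens.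
  exact: linear_ext.
apply: linear_ext => u; rewrite /inv raddf_sum.
rewrite -[LHS]/(hom_apply u _) raddf_sum.
have uE : u = \sum_(i < n) k i ((u : {linear Q -> right_mod C}) (e i)).
  apply: linear_ext => q; rewrite [in LHS](ef q) linear_sum.
  rewrite -[RHS]/(hom_apply q _) raddf_sum; apply: eq_bigr => i _.
  by rewrite linearZ.
rewrite [in RHS]uE linear_sum; apply: eq_bigr => i _.
by rewrite hom_evalE.
Qed.

End HomEvaluation.

(** * Flat and injective modules *)

Lemma inj_surj_bijective (U V : Type) (f : U -> V) :
  injective f -> surj f -> bijective f.
Proof.
by move=> fI /choice[g gK]; exists g => // x; apply: fI; rewrite gK.
Qed.

(** As [u] is constant on the fibres of [f], composing it with any choice of preimages is linear. It
    serves to factor cocycles in degree 0 through the augmentation. *)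
Lemma surj_factor (R : pzRingType) (U V W : lmodType R)
    (f : {linear U -> V}) (u : {linear U -> W}) :
  surj f -> (forall x, f x = 0 -> u x = 0) ->
  exists v : {linear V -> W}, forall x, v (f x) = u x.
Proof.
move=> /choice[s sK] fu.
have fuE x x' : f x = f x' -> u x = u x'.
  by move=> E; apply: subr0_eq; rewrite -raddfB; apply: fu; rewrite linearB E subrr.
have us_lin : linear (u \o s).
  by move=> a y z; rewrite /= -linearP; apply: fuE; rewrite linearP !sK.
exists (HB.pack_for {linear V -> W} (u \o s)
  (GRing.isLinear.Build R _ _ _ _ us_lin)) => x.
by apply: fuE; rewrite sK.
Qed.

Lemma tensor_map_surj (R : pzRingType) (A B : lmodType R^c) (M : lmodType R)
    (f : {linear A -> B}) : surj f -> surj (tensor_map f (@idfun M)).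
Proof.
move=> sf; elim/tensor_ind => [|t u [t' <-] [u' <-]|b m].
- by exists 0; rewrite raddf0.
- by exists (t' + u'); rewrite raddfD.
by have [a <-] := sf b; exists (tens a m); exact: tensor_liftE.
Qed.

(** * Flat modules: acyclicity and the unit [mu] *)

Section FlatModules.
Variables (S R : pzRingType) (C : bimodType S R) (P : proj_res C).
Hypothesis finP : forall n, fin_gen (P n).
Hypothesis acyP : hom_acyclic P C.
Variable F : lmodType R.
Hypothesis flatF : flat F.

Lemma res_tensor_eval n : bijective (tensor_eval C F (P n)).
Proof. by apply: tensor_eval_bijective => //; exact: res_projective. Qed.

(** Hom_S(P, C) is exact in positive degrees, flatness of [F] preserves this, and tensor evaluation
    identifies the result with Hom_S(P, C (x) F). *)
Lemma flat_hom_acyclic : hom_acyclic P (bitensor C F).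
Proof.
move=> n u du; have [inv invK tK] := res_tensor_eval n.+1.
have ex : exact_at (@hom_right_map S R C _ _ (res_diff P n))
    (@hom_right_map S R C _ _ (res_diff P n.+1)).
  move=> w; split=> [dw|[v <-]]; last first.
    by apply: linear_ext => x /=; rewrite res_diff_diff linear0.
  have [v vE] := acyP (Hom_congr dw); exists v; exact: linear_ext.
have [|t' tE] := (flatF ex (inv u)).1.
  apply: (bij_inj (res_tensor_eval n.+2)).
  by rewrite tensor_eval_map tK raddf0; exact: linear_ext.
exists (tensor_eval C F (P n) t' : {linear _ -> _}) => x.
by rewrite -[u]tK -tE tensor_eval_map.
Qed.

Hypothesis homothetyR_bij : bijective (@homothetyR S R C).

(** The coaugmentation R -> Hom_S(P_0, C): homothety restricted along the augmentation. The type
    [(R^c)^o] is [R] as a right module over itself. *)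
Definition aug_right (r : (R^c)^o) : hom_right C (P 0) :=
  @right_mul S R C r \o res_aug P.

Lemma aug_right_linear : linear aug_right.
Proof.
by move=> a r r'; apply: linear_ext => x /=; rewrite /right_mul ractDr ractA.
Qed.

HB.instance Definition _ := GRing.isLinear.Build R^c (R^c)^o (hom_right C (P 0)) _
  aug_right aug_right_linear.

Lemma aug_right_inj : injective aug_right.
Proof.
move=> r r' E; apply: (bij_inj homothetyR_bij); apply: linear_ext => c.
by have [p <-] := res_aug_surj P c; exact: (Hom_congr E).
Qed.

(** A degree 0 cocycle factors through the augmentation as an endomorphism of [C], which is a
    homothety. *)
Lemma aug_right_exact :
  exact_at aug_right (@hom_right_map S R C _ _ (res_diff P 0)).
Proof.
move=> u; split=> [du|[r <-]]; last first.
  by apply: linear_ext => x /=; rewrite res_aug_diff linear0.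
have [||v vE] := @surj_factor S _ _ _ (res_aug P) u.
- exact: res_aug_surj.
- by move=> x /res_exact0[y <-]; exact: (Hom_congr du).
have [inv _ invK] := homothetyR_bij.
exists (inv v); apply: linear_ext => x /=.
by rewrite -vE -[X in _ = GRing.Linear.sort X _](invK v).
Qed.

(** Surjectivity of the canonical map F -> R (x) F; [tens_regular_eq0] gives its injectivity,
    through the retraction [r (x) y |-> r *: y]. *)
Lemma tens_regular (t : tensor (R^c)^o F) : exists x : F, t = tens (1 : (R^c)^o) x.
Proof.
elim/tensor_ind: t => [|_ _ [x ->] [y ->]|r m].
- by exists 0; rewrite tens0r.
- by exists (x + y); rewrite tensDr.
exists ((r : R) *: m); rewrite -tensM; congr tens.
exact/esym/(mulr1 (r : R^c)).
Qed.

Lemma tens_regular_eq0 (x : F) : tens (1 : (R^c)^o) x = 0 -> x = 0.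
Proof.
have b : balanced (fun (r : (R^c)^o) (y : F) => (r : R) *: y).
  split=> [r r' y|r y y'|r a y]; [exact: scalerDl|exact: scalerDr|].
  by rewrite scalerA.
move=> x0; have := tensor_liftE b 1 x.
by rewrite x0 raddf0 => /esym; rewrite scale1r.
Qed.

(** Tensor evaluation turns the coaugmentation tensored with [F] into [mu] followed by restriction
    to [P 0], so exactness of the former decides bijectivity of [mu]. *)
Lemma tensor_eval_aug x : tensor_eval C F (P 0) (tensor_map aug_right (@idfun F)
  (tens (1 : (R^c)^o) x)) = precomp (res_aug P) (@mu S R C F x).
Proof.
rewrite [tensor_map _ _ _]tensor_liftE; apply: linear_ext => p.
by rewrite tensor_evalE /= /right_mul ract1.
Qed.

Lemma flat_mu : bijective (@mu S R C F).
Proof.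
apply: inj_surj_bijective => [x y /eqP|u].
  rewrite -subr_eq0 -raddfB => /eqP mu0.
  apply/eqP; rewrite -subr_eq0; apply/eqP/tens_regular_eq0.
  (* Injectivity of the coaugmentation, written as exactness at [R] after the zero map so that
     flatness applies to it. *)
  have ex : exact_at (\0 : {linear (R^c)^o -> (R^c)^o}) aug_right.
    move=> r; split=> [r0|[r' <-]]; last by rewrite raddf0.
    by exists 0; apply: aug_right_inj; rewrite r0 raddf0.
  have [|t <-] := (flatF ex (tens (1 : (R^c)^o) (x - y))).1.
    by apply: (bij_inj (res_tensor_eval 0)); rewrite tensor_eval_aug mu0 !raddf0.
  exact: tensor_map0.
have [inv invK tK] := res_tensor_eval 0.
(* [w] vanishes on boundaries, so it comes from R (x) F by exactness at Hom_S(P_0, C). *)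
pose w := precomp (res_aug P) u.
have [|t tE] := (flatF aug_right_exact (inv w)).1.
  apply: (bij_inj (res_tensor_eval 1)); rewrite tensor_eval_map tK raddf0.
  by apply: linear_ext => p /=; rewrite res_aug_diff linear0.
have [x xE] := tens_regular t; exists x; apply: linear_ext => c.
have [p <-] := res_aug_surj P c.
have := tK w; rewrite -tE xE tensor_eval_aug => E.
exact: (Hom_congr E p).
Qed.

End FlatModules.

Lemma injective_hom_acyclic (R : pzRingType) (M I : lmodType R) (P : proj_res M) :
  injective_module I -> hom_acyclic P I.
Proof.
move=> iI n u du; apply: (injective_extend iI) => x /res_exactS[y <-].
exact: du.
Qed.

(** * Injective modules: acyclicity and the counit [nu] *)

Section InjectiveModules.
Variables (S R : pzRingType) (C : bimodType S R) (Q : proj_res (right_mod C)).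
Hypothesis finQ : forall n, fin_gen (Q n).
Hypothesis acyQ : hom_acyclic Q (right_mod C).
Variable I : lmodType S.
Hypothesis injI : injective_module I.

Lemma res_hom_eval n : bijective (hom_eval C I (Q n)).
Proof. by apply: hom_eval_bijective => //; exact: res_projective. Qed.

(** By injectivity of [I], the functional given by [t] extends along Hom(d, C) to Hom(Q_{n+1}, C),
    and hom evaluation turns the extension into a tensor with boundary [t]. *)
Lemma hom_eval_lift n (t : tensor (Q n) (bihom C I)) :
  (forall u : hom_left C (Q n), (forall x, (u : {linear _ -> _}) (res_diff Q n x) = 0) ->
    (hom_eval C I (Q n) t : {linear _ -> _}) u = 0) ->
  exists t', tensor_map (res_diff Q n) (@idfun (bihom C I)) t' = t.
Proof.
move=> H; have [inv invK tK] := res_hom_eval n.+1.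
have [||v vE] := @injective_extend S I _ _
  (@hom_left_map S R C _ _ (res_diff Q n)) (hom_eval C I (Q n) t) => //.
  by move=> u du; apply: H => x; exact: (Hom_congr du).
exists (inv v); apply: (bij_inj (res_hom_eval n)).
by rewrite hom_eval_map tK; exact: linear_ext.
Qed.

Lemma injective_tensor_acyclic : tensor_acyclic Q (bihom C I).
Proof.
(* A cocycle [u] is a coboundary [v \o d], and [t] evaluated at [u] is the boundary of [t] evaluated
   at [v]. *)
move=> n t dt; apply: hom_eval_lift => u /acyQ[v vE].
have -> : u = hom_left_map (res_diff Q n) v by apply: linear_ext => x; rewrite -vE.
have := congr1 (hom_eval C I (Q n)) dt; rewrite hom_eval_map raddf0 => E.
exact: (Hom_congr E v).
Qed.

Hypothesis homothetyS_bij : bijective (@homothetyS S R C).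

Definition aug_left (s : S^o) : hom_left C (Q 0) := @left_mul S R C s \o res_aug Q.

Lemma aug_left_linear : linear aug_left.
Proof.
move=> a r r'; apply: linear_ext => x /=.
by rewrite /left_mul scalerDl -scalerA.
Qed.

HB.instance Definition _ := GRing.isLinear.Build S S^o (hom_left C (Q 0)) _
  aug_left aug_left_linear.

Lemma aug_left_inj : injective aug_left.
Proof.
move=> r r' E; apply: (bij_inj homothetyS_bij); apply: linear_ext => c.
by have [p <-] := res_aug_surj Q c; exact: (Hom_congr E).
Qed.

Lemma aug_left_ker (u : hom_left C (Q 0)) :
  (forall x, (u : {linear _ -> _}) (res_diff Q 0 x) = 0) -> exists s, aug_left s = u.
Proof.
move=> du; have [||v vE] := @surj_factor R^c _ _ _ (res_aug Q) u.
- exact: res_aug_surj.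
- by move=> x /res_exact0[y <-].
have [inv _ invK] := homothetyS_bij.
exists (inv v); apply: linear_ext => x /=.
by rewrite -vE -[X in _ = GRing.Linear.sort X _](invK v).
Qed.

(** [aug_left 1] is the augmentation itself; evaluating there computes [nu] on the degree 0 term of
    the resolution. *)
Lemma nu_aug t : @nu S R C I (tensor_map (res_aug Q) (@idfun (bihom C I)) t) =
  (hom_eval C I (Q 0) t : {linear _ -> _}) (aug_left 1).
Proof.
apply: (tensor_ext (f := @nu S R C I \o tensor_map (res_aug Q) (@idfun (bihom C I)))
  (g := hom_apply (aug_left 1) \o hom_eval C I (Q 0))) => q f.
rewrite /= !tensor_liftE /=.
have := nuE (res_aug Q q : C) f; rewrite /bitens => ->.
by rewrite /= /eval_apply /hom_apply /eval_apply /= /left_mul scale1r.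
Qed.

Lemma injective_nu : bijective (@nu S R C I).
Proof.
apply: inj_surj_bijective => [x y /eqP|y].
  rewrite -subr_eq0 -raddfB => /eqP nu0.
  apply/eqP; rewrite -subr_eq0; apply/eqP; move: (x - y) nu0 => {x y} t.
  have [u <-] := tensor_map_surj (M := bihom C I) (res_aug_surj Q) t => nu0.
  (* Degree 0 cocycles are the multiples [s *: aug_left 1], on which [u] evaluates to [s] times the
     zero value of [nu]; so [u] is a boundary and dies under the augmentation. *)
  have [|w <-] := @hom_eval_lift 0 u.
    move=> _ /aug_left_ker[s <-].
    have -> : aug_left s = (s : S) *: aug_left 1.
      by rewrite -[in LHS](mulr1 s); exact: (linearZ_LR aug_left).
    rewrite (linearZ_LR (hom_eval C I (Q 0) u : {linear _ -> _})) /=.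
    by rewrite -nu_aug nu0 scaler0.
  by rewrite tensor_map_comp tensor_map0 // => q /=; rewrite res_aug_diff.
have y_lin : linear (fun s : S^o => (s : S) *: y).
  by move=> a s s'; rewrite scalerDl scalerA.
(* The map [s |-> s *: y] extends along the injective [aug_left]; the corresponding tensor is sent
   to [1 *: y] by [nu]. *)
have [||v vE] := @injective_extend S I _ _ aug_left
  (HB.pack_for {linear S^o -> I} (fun s : S^o => (s : S) *: y)
    (GRing.isLinear.Build S _ _ _ _ y_lin)) => //.
  move=> s s0 /=; suff -> : s = 0 by rewrite scale0r.
  by apply: aug_left_inj; rewrite raddf0.
have [inv _ tK] := res_hom_eval 0.
exists (tensor_map (res_aug Q) (@idfun (bihom C I)) (inv v)).
by rewrite nu_aug tK vE /= scale1r.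
Qed.

End InjectiveModules.

(** * Isomorphism invariance *)

Section Isomorphisms.
Variable R : pzRingType.
Implicit Types M N K : lmodType R.

Lemma linear_inverse M N (f : {linear M -> N}) : bijective f ->
  exists g : {linear N -> M}, cancel f g /\ cancel g f.
Proof.
case=> g fK gK.
have g_lin : linear g by move=> a x y; apply: (can_inj fK); rewrite linearP !gK.
by exists (HB.pack_for {linear N -> M} g (GRing.isLinear.Build R _ _ _ _ g_lin)).
Qed.

Lemma isomorphic_inverse M N : isomorphic M N ->
  exists (f : {linear M -> N}) (g : {linear N -> M}), cancel f g /\ cancel g f.
Proof. by case=> f /linear_inverse[g fg]; exists f, g. Qed.

Lemma isomorphic_sym M N : isomorphic M N -> isomorphic N M.
Proof. by case/isomorphic_inverse=> f [g [fK gK]]; exists g, f. Qed.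

Lemma isomorphic_trans M N K : isomorphic M N -> isomorphic N K -> isomorphic M K.
Proof. by move=> [f fb] [g gb]; exists (g \o f); exact: bij_comp. Qed.

Lemma projective_iso M N : isomorphic M N -> projective M -> projective N.
Proof.
case/isomorphic_inverse=> f [g [_ gK]] pM U V p q sp.
have [h hE] := pM U V p (q \o f) sp; exists (h \o g) => x /=.
by have /= -> := hE (g x); rewrite gK.
Qed.

Lemma injective_iso M N : isomorphic M N -> injective_module M -> injective_module N.
Proof.
case/isomorphic_inverse=> f [g [_ gK]] iM U V p q ip.
have [h hE] := iM U V p (g \o q) ip; exists (f \o h) => x /=.
by have /= -> := hE x; rewrite gK.
Qed.

Lemma tensor_map_id_comp (A : lmodType R^c) M N K
    (f : {linear M -> N}) (g : {linear N -> K}) t :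
  tensor_map (@idfun A) g (tensor_map (@idfun A) f t) =
  tensor_map (@idfun A) (g \o f) t.
Proof.
apply: (tensor_ext (f := tensor_map (@idfun A) g \o tensor_map (@idfun A) f)).
by move=> a m; rewrite /= !tensor_liftE.
Qed.

Lemma tensor_map_can (A : lmodType R^c) M N
    (f : {linear M -> N}) (g : {linear N -> M}) :
  cancel f g -> cancel (tensor_map (@idfun A) f) (tensor_map (@idfun A) g).
Proof.
move=> fK t; rewrite tensor_map_id_comp.
by apply: (tensor_ext (g := idfun)) => a m; rewrite [LHS]tensor_liftE /= fK.
Qed.

Lemma tensor_map_swap (A B : lmodType R^c) M N
    (d : {linear A -> B}) (f : {linear M -> N}) t :
  tensor_map d (@idfun N) (tensor_map (@idfun A) f t) =
  tensor_map (@idfun B) f (tensor_map d (@idfun M) t).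
Proof.
apply: (tensor_ext (f := tensor_map d (@idfun N) \o tensor_map (@idfun A) f)
  (g := tensor_map (@idfun B) f \o tensor_map d (@idfun M))).
by move=> a m; rewrite /= !tensor_liftE.
Qed.

Lemma flat_iso M N : isomorphic M N -> flat M -> flat N.
Proof.
case/isomorphic_inverse=> f [g [fK gK]] fM A B D p q pq t.
have fcan X := tensor_map_can (A := X) fK; have gcan X := tensor_map_can (A := X) gK.
have ex := fM _ _ _ _ _ pq; split=> [qt|[u <-]].
  have [|u uE] := (ex (tensor_map (@idfun B) g t)).1.
    by rewrite tensor_map_swap qt raddf0.
  by exists (tensor_map (@idfun A) f u); rewrite tensor_map_swap uE gcan.
apply: (can_inj (gcan D)); rewrite -!tensor_map_swap raddf0.
by apply/ex; exists (tensor_map (@idfun A) g u).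
Qed.

Lemma hom_acyclic_iso K (P : proj_res K) M N :
  isomorphic M N -> hom_acyclic P M -> hom_acyclic P N.
Proof.
case/isomorphic_inverse=> f [g [_ gK]] H n u du.
have [|v vE] := H n (g \o u); first by move=> x /=; rewrite du raddf0.
by exists (f \o v) => x /=; rewrite vE /= gK.
Qed.

Lemma tensor_acyclic_iso (A : lmodType R^c) (P : proj_res A) M N :
  isomorphic M N -> tensor_acyclic P M -> tensor_acyclic P N.
Proof.
case/isomorphic_inverse=> f [g [_ gK]] H n t dt.
have [|u uE] := H n (tensor_map (@idfun _) g t).
  by rewrite tensor_map_swap dt raddf0.
exists (tensor_map (@idfun _) f u).
by rewrite tensor_map_swap uE (tensor_map_can gK).
Qed.

End Isomorphisms.

(** * Foxby equivalence *)

Section FoxbyEquivalence.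
Variables (S R : pzRingType) (C : bimodType S R).

Lemma mu_natural (M M' : lmodType R) (f : {linear M -> M'}) m :
  mu C (f m) = bihom_map (bitensor_map f) (mu C m).
Proof. by apply: linear_ext => c /=; rewrite [RHS]bitensor_mapE. Qed.

Lemma nu_natural (N N' : lmodType S) (g : {linear N -> N'}) t :
  g (@nu S R C N t) = nu (bitensor_map (bihom_map g) t).
Proof.
apply: (tensor_ext (f := g \o @nu S R C N)
  (g := @nu S R C N' \o bitensor_map (bihom_map g))) => c h.
rewrite /= -[tens c h]/(bitens c h) bitensor_mapE.
by rewrite [X in g X]nuE nuE.
Qed.

Lemma bihom_map_bij (N N' : lmodType S) (g : {linear N -> N'}) :
  bijective g -> bijective (@bihom_map S R C _ _ g).
Proof.
case/linear_inverse=> h [gK hK].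
by exists (bihom_map h) => u; apply: linear_ext => x /=; rewrite (gK, hK).
Qed.

Lemma bitensor_map_bij (M M' : lmodType R) (f : {linear M -> M'}) :
  bijective f -> bijective (@bitensor_map S R C _ _ f).
Proof.
by case/linear_inverse=> g [fK gK]; exists (bitensor_map g); exact: tensor_map_can.
Qed.

Lemma bitensor_iso (M M' : lmodType R) :
  isomorphic M M' -> isomorphic (bitensor C M) (bitensor C M').
Proof. by case=> f /bitensor_map_bij fb; exists (bitensor_map f). Qed.

Lemma bihom_iso (N N' : lmodType S) :
  isomorphic N N' -> isomorphic (bihom C N) (bihom C N').
Proof. by case=> f /bihom_map_bij fb; exists (bihom_map f). Qed.

Lemma Auslander_iso (M M' : lmodType R) :
  isomorphic M M' -> Auslander C M -> Auslander C M'.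
Proof.
move=> iM [/Tor_trivial A1 /Ext_trivial A2 A3]; split.
- by apply/Tor_trivial; exact: tensor_acyclic_iso A1.
- by apply/Ext_trivial; apply: hom_acyclic_iso A2; exact: bitensor_iso.
have [f [g [fK gK]]] := isomorphic_inverse iM.
(* By naturality, [mu] at [M'] is [mu] at [M] conjugated by the isomorphism. *)
apply: (eq_bij (f := bihom_map (bitensor_map f) \o (@mu S R C M \o g))).
  apply: bij_comp; last by apply: bij_comp => //; exists f.
  by apply/bihom_map_bij/bitensor_map_bij; exists g.
by move=> m; rewrite /= -mu_natural gK.
Qed.

Lemma Bass_iso (N N' : lmodType S) : isomorphic N N' -> Bass C N -> Bass C N'.
Proof.
move=> iN [/Ext_trivial B1 /Tor_trivial B2 B3]; split.
- by apply/Ext_trivial; exact: hom_acyclic_iso B1.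
- by apply/Tor_trivial; apply: tensor_acyclic_iso B2; exact: bihom_iso.
have [f [g [fK gK]]] := isomorphic_inverse iN.
apply: (eq_bij (f := f \o (@nu S R C N \o bitensor_map (bihom_map g)))).
  apply: bij_comp; first by exists g.
  apply: bij_comp => //.
  by apply/bitensor_map_bij/bihom_map_bij; exists f.
by move=> t; rewrite /= -nu_natural gK.
Qed.

Lemma mu_iso (M : lmodType R) :
  Auslander C M -> isomorphic (bihom C (bitensor C M)) M.
Proof. by case=> _ _ b; apply: isomorphic_sym; exists (@mu S R C M). Qed.

Lemma nu_iso (N : lmodType S) :
  Bass C N -> isomorphic (bitensor C (bihom C N)) N.
Proof. by case=> _ _ b; exists (@nu S R C N). Qed.

(** (B1) is (A2), (B2) is (A1) transported along [mu], and (B3) follows from the triangle identity: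
    [nu] after C (x) [mu] is the identity. *)
Lemma Auslander_Bass (M : lmodType R) : Auslander C M -> Bass C (bitensor C M).
Proof.
move=> AM; case: (AM) => A1 A2 A3; split=> //.
  apply/Tor_trivial/(tensor_acyclic_iso (isomorphic_sym (mu_iso AM))).
  exact/Tor_trivial.
apply: (bij_can_bij (bitensor_map_bij A3)) => t.
apply: (tensor_ext (f := @nu S R C _ \o bitensor_map (@mu S R C M)) (g := idfun)) => c m.
by rewrite /= -[tens c m]/(bitens c m) bitensor_mapE nuE.
Qed.

(** Dual argument: [mu] at Hom(C, N) is a one-sided inverse of the bijection Hom(C, [nu]), hence
    bijective. *)
Lemma Bass_Auslander (N : lmodType S) : Bass C N -> Auslander C (bihom C N).
Proof.
move=> BN; case: (BN) => B1 B2 B3; split=> //.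
  apply/Ext_trivial/(hom_acyclic_iso (isomorphic_sym (nu_iso BN))).
  exact/Ext_trivial.
have [inv nuK invK] := bihom_map_bij B3.
have muK : cancel (@mu S R C (bihom C N)) (bihom_map (@nu S R C N)).
  by move=> h; apply: linear_ext => c /=; exact: nuE.
apply: inj_surj_bijective (can_inj muK) _ => u; exists (bihom_map (@nu S R C N) u).
by apply: (can_inj nuK); rewrite muK.
Qed.

(** [mu] and [nu] are invertible on the Auslander and Bass classes, hence on any subclasses that the
    functors exchange; this covers all four equivalences. *)
Lemma restrict_equivalence (P : lmodType R -> Prop) (Q : lmodType S -> Prop) :
  (forall M, P M -> Auslander C M) -> (forall N, Q N -> Bass C N) ->
  (forall M, P M -> Q (bitensor C M)) -> (forall N, Q N -> P (bihom C N)) ->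
  restrict_to_equivalence (tensor_functor C) (hom_functor C) P Q.
Proof.
move=> PA QB PQ QP; exists PQ, QP; split.
  (* A linear inverse is chosen for every object, as a natural isomorphism carries its inverses as
     data. *)
  have muV (M : full_subcat (X := Mod R) P) :=
    cid (linear_inverse (auslander3 (PA _ (svalP M)))).
  constructor; unshelve refine (@NatIso (full_subcat (X := Mod R) P)
    (full_subcat (X := Mod R) P) (id_functor _)
    (comp_functor (restrict (F := hom_functor C) QP)
       (restrict (F := tensor_functor C) PQ))
    (fun M => (@mu S R C (sval M) : {linear sval M -> bihom C (bitensor C (sval M))}))
    (fun M => sval (muV M)) _ _ _).
  - by move=> M N f; apply: linear_ext => m; exact: mu_natural.
  - by move=> M; apply: linear_ext => m; exact: (svalP (muV M)).1.
  - by move=> M; apply: linear_ext => m; exact: (svalP (muV M)).2.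
have nuV (N : full_subcat (X := Mod S) Q) :=
  cid (linear_inverse (bass3 (QB _ (svalP N)))).
constructor; unshelve refine (@NatIso (full_subcat (X := Mod S) Q)
  (full_subcat (X := Mod S) Q)
  (comp_functor (restrict (F := tensor_functor C) PQ)
     (restrict (F := hom_functor C) QP)) (id_functor _)
  (fun N => (@nu S R C (sval N) : {linear bitensor C (bihom C (sval N)) -> sval N}))
  (fun N => sval (nuV N)) _ _ _).
- by move=> M N f; apply: linear_ext => t; exact/esym/nu_natural.
- by move=> M; apply: linear_ext => m; exact: (svalP (nuV M)).1.
- by move=> M; apply: linear_ext => m; exact: (svalP (nuV M)).2.
Qed.

Hypothesis HC : semidualizing C.

Lemma flat_Auslander (F : lmodType R) : flat F -> Auslander C F.
Proof.
move=> fF; case: HC => -[P fP] _ _ b2 /Ext_trivial c1 _.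
(* Ext vanishing passes from the free resolution to the finite one, where evaluation is bijective,
   and returns for (A2). For (A1), [F] preserves exactness of the free resolution. *)
have aP := hom_acyclic_res (Q := P) c1; split; last exact: flat_mu fP _ fF b2.
  by apply/Tor_trivial => n t; exact: (fF _ _ _ _ _ (@res_exactS _ _ _ n) t).1.
by apply/Ext_trivial; apply: hom_acyclic_res (flat_hom_acyclic fP aP fF).
Qed.

Lemma injective_Bass (I : lmodType S) : injective_module I -> Bass C I.
Proof.
move=> iI; case: HC => _ [Q fQ] b1 _ _ /Ext_trivial c2.
have aQ := hom_acyclic_res (Q := Q) c2; split; last exact: injective_nu fQ _ iI b1.
  by apply/Ext_trivial; exact: injective_hom_acyclic.
by apply/Tor_trivial; apply: tensor_acyclic_res (injective_tensor_acyclic fQ aQ iI).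
Qed.

End FoxbyEquivalence.

Theorem theorem1 (R S : pzRingType) (C : bimodType S R)
    (HC : semidualizing C) :
  ((forall M : lmodType R, projective M -> flat M) /\
   (forall M : lmodType R, flat M -> Auslander C M) /\
   (forall M : lmodType R, C_injective C M -> Auslander C M)) /\
  ((forall N : lmodType S, C_projective C N -> C_flat C N) /\
   (forall N : lmodType S, C_flat C N -> Bass C N) /\
   (forall N : lmodType S, injective_module N -> Bass C N)) /\
  (restrict_to_equivalence (tensor_functor C) (hom_functor C)
     (@projective R) (C_projective C) /\
   restrict_to_equivalence (tensor_functor C) (hom_functor C)
     (@flat R) (C_flat C) /\
   restrict_to_equivalence (tensor_functor C) (hom_functor C)
     (Auslander C) (Bass C) /\
   restrict_to_equivalence (tensor_functor C) (hom_functor C)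
     (C_injective C) (@injective_module S)).
Proof.
have PF (M : lmodType R) : projective M -> flat M by exact: projective_flat.
have FA (M : lmodType R) : flat M -> Auslander C M by exact: flat_Auslander.
have IB (N : lmodType S) : injective_module N -> Bass C N by exact: injective_Bass.
have CIA (M : lmodType R) : C_injective C M -> Auslander C M.
  case=> I iI /isomorphic_sym/Auslander_iso; apply.
  exact/Bass_Auslander/IB.
have CPF (N : lmodType S) : C_projective C N -> C_flat C N.
  by case=> P /PF fP iN; exists P.
have CFB (N : lmodType S) : C_flat C N -> Bass C N.
  case=> F fF /isomorphic_sym/Bass_iso; apply.
  exact/Auslander_Bass/FA.
have refl (T : pzRingType) (M : lmodType T) : isomorphic M M.
  by exists idfun; exists idfun.
(* Recovers [M] from C (x) M through [mu], so that Hom(C, -) returns C-projective and C-flat modules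
   to projective and flat ones. *)
have homC (N : lmodType S) (M : lmodType R) : Auslander C M ->
    isomorphic N (bitensor C M) -> isomorphic M (bihom C N).
  move=> AM /(bihom_iso C)/isomorphic_trans/(_ (mu_iso AM)).
  exact: isomorphic_sym.
split; [by []|split; [by []|split; [|split; [|split]]]].
- apply: restrict_equivalence => [M /PF/FA//|N /CPF/CFB//|M pM|N [P pP iN]].
    by exists M.
  by apply: projective_iso (pP); apply: homC => //; exact/FA/PF.
- apply: restrict_equivalence => // [M fM|N [F fF iN]]; first by exists M.
  by apply: flat_iso (fF); apply: homC => //; exact: FA.
- apply: restrict_equivalence => //; [exact: Auslander_Bass|exact: Bass_Auslander].
apply: restrict_equivalence => // [M [I iI iM]|N iN]; last by exists N.
(* For [M] isomorphic to Hom(C, I), the counit [nu] identifies C (x) M with [I]. *)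
apply: injective_iso (iI); apply: isomorphic_sym.
exact: isomorphic_trans (bitensor_iso C iM) (nu_iso (IB _ iI)).
Qed.
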